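(* Let $M$ be a finitely generated $\mathbb{Z}[D]$-module and $\ell$ a prime. Then \[-L_\ell(M)\le v_\ell(\mathcal C_\Theta(M))\le U_\ell(M),\] where $L_\ell(M)=U_\ell(M)=0$ if $\ell\nmid q$, and if $\ell\mid q$, \begin{align*} L_\ell(M)&=2v_\ell\bigl(|M_{\mathrm{tors}}^D/qM_{\mathrm{tors}}^D|\bigr)+2\,\mathrm{rk}_\mathbb{Z}(M^D)\,v_\ell(q)-v_\ell(h_R(M)),\\ U_\ell(M)&=2v_\ell\bigl(|M_{\mathrm{tors}}^R/qM_{\mathrm{tors}}^R|\bigr)+2\,\mathrm{rk}_\mathbb{Z}(M^R)\,v_\ell(q)-v_\ell(h_R(M)). \end{align*}
   Context: Let $q>1$ be an odd integer, $D=\langle\rho,\sigma:\rho^q=\sigma^2=1,\ \sigma\rho\sigma^{-1}=\rho^{-1}\rangle$ the dihedral group of order $2q$, $R=\langle\rho\rangle$, $\Sigma=\langle\sigma\rangle$, and $\Theta=1+2D-R-2\Sigma$, i.e. the $D$-Brauer relation $\sum_Hn_HH$ with $n_{\{1\}}=1$, $n_D=2$, $n_R=-1$, $n_\Sigma=-2$ and $n_H=0$ for all other subgroups. For a finitely generated $\mathbb{Z}[D]$-module $M$, write $M_{\mathrm{tors}}$ for its $\mathbb{Z}$-torsion subgroup and $M_{\mathrm{tf}}=M/M_{\mathrm{tors}}$; the regulator constant is $\mathcal C_\Theta(M)=\prod_{H\le D}\bigl(|M_{\mathrm{tors}}^H|^{-2}\det(\tfrac{1}{|H|}\langle\cdot,\cdot\rangle|_{(M^H)_{\mathrm{tf}}})\bigr)^{n_H}$,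 where $\langle\cdot,\cdot\rangle:M\times M\to\mathscr L$ is any $D$-invariant $\mathbb{Z}$-bilinear pairing into a field $\mathscr L\supseteq\mathbb{Q}$ non-degenerate on $M_{\mathrm{tf}}$ and the determinant is taken on a $\mathbb{Z}$-basis of $(M^H)_{\mathrm{tf}}$ (independent of the pairing). $\hat H^i(H,M)$ denotes Tate cohomology and $\hat h^i(H,M)=|\hat H^i(H,M)|$. The $R$-Herbrand quotient is $h_R(M)=\hat h^0(R,M)/\hat h^{-1}(R,M)$. $\mathrm{rk}_\mathbb{Z}$ denotes $\mathbb{Z}$-rank and $v_\ell$ the $\ell$-adic valuation. *)

(* Defs.v *)
From HB Require Import structures.
From mathcomp Require Import all_boot all_order all_algebra.
From Stdlib Require Import ClassicalEpsilon.
Set Implicit Arguments.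
Unset Strict Implicit.
Unset Printing Implicit Defensive.
Import Order.TTheory GRing.Theory Num.Theory.
Local Open Scope ring_scope.

(* A Z[D]-module, D = <rho, sigma | rho^q = sigma^2 = 1, sigma rho sigma^-1 = rho^-1>,
   is an abelian group M (a zmodType) with additive maps r (action of rho) and
   s (action of sigma) satisfying the defining relations of D. *)
Definition additive_map (M : zmodType) (f : M -> M) : Prop :=
  forall x y, f (x + y) = f x + f y.

Definition dihedral_action (q : nat) (M : zmodType) (r s : M -> M) : Prop :=
  [/\ additive_map r, additive_map s,
      (forall x, iter q r x = x),
      (forall x, s (s x) = x) &
      (forall x, s (r (s x)) = iter q.-1 r x)].

Definition dact (M : zmodType) (r s : M -> M) (a b : nat) (x : M) : M :=
  iter a r (iter b s x).

Definition dih_fingen (q : nat) (M : zmodType) (r s : M -> M) : Prop :=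
  exists gs : seq M, forall m : M,
    exists c : 'I_(size gs) -> 'I_q -> 'I_2 -> int,
      m = \sum_(i < size gs) \sum_(a < q) \sum_(b < 2)
            dact r s a b (gs`_i) *~ c i a b.

Definition is_tors (M : zmodType) (x : M) : Prop :=
  exists n : nat, (0 < n)%N /\ x *+ n = 0.

(* n is the index |A / B| of the subgroup B in the subgroup A (B inside A):
   f enumerates a complete, irredundant set of coset representatives. *)
Definition has_qcard (M : zmodType) (A B : M -> Prop) (n : nat) : Prop :=
  exists f : 'I_n -> M,
    [/\ (forall i, A (f i)),
        (forall a, A a -> exists i, B (a - f i)) &
        (forall i j, B (f i - f j) -> i = j)].

(* |A / B| (finite in all uses below) *)
Definition qcard (M : zmodType) (A B : M -> Prop) : nat :=
  epsilon (inhabits 0%N) (has_qcard A B).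

Definition scard (M : zmodType) (A : M -> Prop) : nat :=
  qcard A (fun x => x = 0).

Definition nmul_set (M : zmodType) (n : nat) (A : M -> Prop) : M -> Prop :=
  fun y => exists x, A x /\ y = x *+ n.

Definition invR (M : zmodType) (r : M -> M) : M -> Prop := fun x => r x = x.
Definition invS (M : zmodType) (s : M -> M) : M -> Prop := fun x => s x = x.
Definition invD (M : zmodType) (r s : M -> M) : M -> Prop :=
  fun x => r x = x /\ s x = x.
Definition tors_in (M : zmodType) (A : M -> Prop) : M -> Prop :=
  fun x => is_tors x /\ A x.

Definition normR (q : nat) (M : zmodType) (r : M -> M) (x : M) : M :=
  \sum_(i < q) iter i r x.

Definition augR (M : zmodType) (r : M -> M) : M -> Prop :=
  fun y => exists (k : nat) (e : 'I_k -> nat) (m : 'I_k -> M),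
    y = \sum_(j < k) (iter (e j) r (m j) - m j).

Definition hhat0R (q : nat) (M : zmodType) (r : M -> M) : nat :=
  qcard (invR r) (fun y => exists x, y = normR q r x).

Definition hhatm1R (q : nat) (M : zmodType) (r : M -> M) : nat :=
  qcard (fun x => normR q r x = 0) (augR r).

(* b is a Z-basis of (A)_tf, i.e. b_i in A whose images in A/A_tors form a Z-basis *)
Definition tf_basis (M : zmodType) (A : M -> Prop) (n : nat) (b : 'I_n -> M) : Prop :=
  [/\ (forall i, A (b i)),
      (forall a, A a -> exists c : 'I_n -> int, is_tors (a - \sum_(i < n) b i *~ c i)) &
      (forall c : 'I_n -> int, is_tors (\sum_(i < n) b i *~ c i) -> forall i, c i = 0)].

Definition gram (M : zmodType) (L : fieldType) (pr : M -> M -> L) (n : nat)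
  (b : 'I_n -> M) : 'M[L]_n := \matrix_(i, j) pr (b i) (b j).

(* D-invariant Z-bilinear pairing, non-degenerate on M_tf (the Gram matrix of a
   Z-basis of M_tf is invertible) *)
Definition good_pairing (M : zmodType) (r s : M -> M) (L : fieldType)
  (pr : M -> M -> L) : Prop :=
  [/\ (forall x y z, pr (x + y) z = pr x z + pr y z),
      (forall x y z, pr x (y + z) = pr x y + pr x z),
      (forall x y, pr (r x) (r y) = pr x y),
      (forall x y, pr (s x) (s y) = pr x y) &
      (forall n (b : 'I_n -> M), tf_basis (fun _ => True) b -> \det (gram pr b) != 0)].

(* the factor |M_tors^H|^{-2} det(1/|H| <,>|_{(M^H)_tf}) *)
Definition reg_factor (M : zmodType) (L : fieldType) (pr : M -> M -> L)
  (T h : nat) (n : nat) (b : 'I_n -> M) : L :=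
  (T%:R ^- 2) * \det ((h%:R)^-1 *: gram pr b).

(* regulator constant for Theta = 1 + 2D - R - 2Sigma; bases b1, bD, bR, bS of
   M_tf, (M^D)_tf, (M^R)_tf, (M^Sigma)_tf *)
Definition regC_Theta (q : nat) (M : zmodType) (r s : M -> M) (L : fieldType)
  (pr : M -> M -> L) (n1 nD nR nS : nat) (b1 : 'I_n1 -> M) (bD : 'I_nD -> M)
  (bR : 'I_nR -> M) (bS : 'I_nS -> M) : L :=
  reg_factor pr (scard (tors_in (fun _ : M => True))) 1 b1
  * reg_factor pr (scard (tors_in (invD r s))) (2 * q) bD ^+ 2
  * (reg_factor pr (scard (tors_in (invR r))) q bR)^-1
  * (reg_factor pr (scard (tors_in (invS s))) 2 bS) ^- 2.

Definition vrat (l : nat) (c : rat) : int :=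
  (logn l `|numq c|%N)%:Z - (logn l `|denq c|%N)%:Z.

Definition vnat (l n : nat) : int := (logn l n)%:Z.

(* Main.v *)
Require Import Defs.
From HB Require Import structures.
From mathcomp Require Import all_boot all_order all_algebra.
From Stdlib Require Import ClassicalEpsilon.
From mathcomp Require Import zify ring.
Import Order.TTheory GRing.Theory Num.Theory.
Set Implicit Arguments.
Unset Strict Implicit.
Unset Printing Implicit Defensive.
Local Open Scope ring_scope.

(* The argument is integral and uniform in [l].  Let w be the square root of rho
   in R, d = w^-1 - w, N the norm of R, and for a map f between finitely generated
   groups with finite kernel and cokernel put h(f) = |coker f| / |ker f|.  The maps
     f : M^S + M^S + M^R -> M + M^D + M^D,   (x, y, z) |-> (x + w y + z, N x, N y),
     f' : M + M^D + M^D -> M^S + M^S + M^R,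
          (m, u, v) |-> ((1 + s) m + u, (1 + s) w^-1 m + v, N m)
   are adjoint for the normalised pairings, so that C_Theta(M) = +- h(f') / h(f):
   the Gram determinants differ by det f' / det f, and the torsion factors are
   those relating determinants to indices.  Splitting off fixed points gives
   h(f) = q^(2 rk M^D) h(g) and h(f') = q^(rk M^R) h(g') with
     g : (M^S / M^D)^2 -> M / M^R,   (x, y) |-> x + w y,
     g' : M / M^R -> (M^S / M^D)^2,   m |-> ((1 + s) m, (1 + s) w^-1 m).
   With J (x, y) = (y, - x) one has g J g' = d, while h(d) h_R(M) = q^(rk M^R);
   hence C_Theta(M) h_R(M) = q^(2 rk M^R - 2 rk M^D) h(g)^-2 and
   h_R(M) / C_Theta(M) = q^(2 rk M^D) h(g')^-2.  Finally d embeds ker g in M^R[q]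
   (through y) and ker g' in M^D[q]. *)

(** * Subgroups and indices *)

(** The relation Theta comes from a rational isomorphism of permutation modules, and f is what such
    a D-map induces on fixed points. Since w M^S is the fixed group of rho sigma, and sigma and rho
    sigma generate D, the two copies of M^S meet only in M^D. Taking w instead of rho keeps the
    symmetry s w = w^-1 s, hence s d = - d s, which makes g J g' collapse to d; oddness of q is what
    puts w in R. As d = (1 - r) w^-1, its kernel is M^R and its image the augmentation submodule, so
    it sees the Tate cohomology of R. Averaging over D would introduce a factor 2q and spoil the
    prime 2. The quasi-inverses of f and f' use instead a discrete Green operator P, with (w - w^-1)
    P = q - N, and every composite is multiplication by q exactly. Hence no localisation at l is
    needed; for l prime to q the same inequalities become equalities with 0, each term being the
    valuation of q or of the order of a group killed by q. *)

Record subgroup (M : zmodType) := Subgroup {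
  smem :> M -> Prop;
  smem0 : smem 0;
  smemB : forall x y, smem x -> smem y -> smem (x - y) }.

Definition sle (M : zmodType) (A B : subgroup M) := forall x, A x -> B x.

Lemma sle_refl (M : zmodType) (A : subgroup M) : sle A A.
Proof. by []. Qed.
#[local] Hint Resolve sle_refl : core.

Section SubgroupTheory.
Variables (M : zmodType) (A : subgroup M).

Lemma smemN x : A x -> A (- x).
Proof. by move=> Ax; rewrite -[- x]add0r; apply: smemB => //; apply: smem0. Qed.

Lemma smemD x y : A x -> A y -> A (x + y).
Proof. by move=> Ax Ay; rewrite -[y]opprK; apply: smemB => //; apply: smemN. Qed.

Lemma smemMn x n : A x -> A (x *+ n).
Proof.
move=> Ax; elim: n => [|n IHn]; first by rewrite mulr0n; apply: smem0.
by rewrite mulrS; apply: smemD.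
Qed.

Lemma smemMz x z : A x -> A (x *~ z).
Proof. by case: z => n Ax; [|apply: smemN]; apply: smemMn. Qed.

Lemma smem_sum (I : finType) (F : I -> M) : (forall i, A (F i)) -> A (\sum_i F i).
Proof. by move=> AF; elim/big_ind: _ => //; [apply: smem0|apply: smemD]. Qed.

Lemma smem_subl x y : A (x - y) -> A y -> A x.
Proof. by move=> Axy Ay; rewrite -[x](subrK y); apply: smemD. Qed.

Lemma smem_subr x y : A (x - y) -> A x -> A y.
Proof. by move=> Axy Ax; rewrite -[y](subKr x); apply: smemB. Qed.

End SubgroupTheory.

#[local] Obligation Tactic := idtac.

Program Definition szero (M : zmodType) := @Subgroup M (fun x => x = 0) _ _.
Next Obligation. by []. Qed.
Next Obligation. by move=> M _ _ -> ->; rewrite subrr. Qed.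

Program Definition sfull (M : zmodType) := @Subgroup M (fun=> True) _ _.
Next Obligation. by []. Qed.
Next Obligation. by []. Qed.

Program Definition smeet (M : zmodType) (A B : subgroup M) :=
  @Subgroup M (fun x => A x /\ B x) _ _.
Next Obligation. by move=> *; split; apply: smem0. Qed.
Next Obligation.
by move=> M A B x y [Ax Bx] [Ay By]; split; apply: smemB.
Qed.

Program Definition sjoin (M : zmodType) (A B : subgroup M) :=
  @Subgroup M (fun x => exists a b, [/\ A a, B b & x = a + b]) _ _.
Next Obligation.
by move=> M A B; exists 0, 0; rewrite addr0; split => //; apply: smem0.
Qed.
Next Obligation.
move=> M A B _ _ [a [b [Aa Bb ->]]] [a' [b' [Aa' Bb' ->]]].
by exists (a - a'), (b - b'); split; [apply: smemB|apply: smemB|rewrite addrACA opprD].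
Qed.

Program Definition simg (M N : zmodType) (f : {additive M -> N}) (A : subgroup M) :=
  @Subgroup N (fun y => exists2 x, A x & y = f x) _ _.
Next Obligation. by move=> M N f A; exists 0; [apply: smem0|rewrite raddf0]. Qed.
Next Obligation.
move=> M N f A _ _ [x Ax ->] [y Ay ->].
by exists (x - y); [apply: smemB|rewrite raddfB].
Qed.

Arguments sjoin : simpl never.
Arguments simg : simpl never.

Program Definition spre (M N : zmodType) (f : {additive M -> N}) (B : subgroup N) :=
  @Subgroup M (fun x => B (f x)) _ _.
Next Obligation. by move=> M N f B /=; rewrite raddf0; apply: smem0. Qed.
Next Obligation. by move=> M N f B x y /= Bx By; rewrite raddfB; apply: smemB. Qed.

Program Definition sprod (M N : zmodType) (A : subgroup M) (B : subgroup N) :=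
  @Subgroup (M * N)%type (fun p => A p.1 /\ B p.2) _ _.
Next Obligation. by move=> M N A B; split; apply: smem0. Qed.
Next Obligation.
by move=> M N A B [x x'] [y y'] [/= Ax Bx] [/= Ay By]; split; apply: smemB.
Qed.

Program Definition stors (M : zmodType) (A : subgroup M) :=
  @Subgroup M (tors_in A) _ _.
Next Obligation.
by move=> M A; split; [exists 1%N; rewrite mul0rn|apply: smem0].
Qed.
Next Obligation.
move=> M A x y [[n [n0 xn]] Ax] [[m [m0 ym]] Ay]; split; last exact: smemB.
exists (n * m)%N; rewrite muln_gt0 n0 m0; split=> //.
by rewrite mulrnBl mulrnA xn mul0rn mulnC mulrnA ym mul0rn subrr.
Qed.

Program Definition snmul (M : zmodType) (n : nat) (A : subgroup M) :=
  @Subgroup M (nmul_set n A) _ _.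
Next Obligation. by move=> M n A; exists 0; rewrite mul0rn; split=> //; apply: smem0. Qed.
Next Obligation.
move=> M n A _ _ [x [Ax ->]] [y [Ay ->]].
by exists (x - y); rewrite mulrnBl; split=> //; apply: smemB.
Qed.

Definition finite_index (M : zmodType) (A B : M -> Prop) := exists n, has_qcard A B n.

(** * Counting cosets: invariance, towers, finiteness *)

Section Counting.
Variable M : zmodType.
Implicit Types A B C : subgroup M.

Lemma has_qcard_fin (I : finType) (A B : M -> Prop) (f : I -> M) :
    (forall i, A (f i)) -> (forall a, A a -> exists i, B (a - f i)) ->
    (forall i j, B (f i - f j) -> i = j) -> has_qcard A B #|I|.
Proof.
move=> Af cov inj; exists (f \o enum_val); split=> [i|a /cov[i Bi]|i j /inj].
- exact: Af.
- by exists (enum_rank i); rewrite /= enum_rankK.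
- exact: enum_val_inj.
Qed.

Lemma has_qcard_leq (N : zmodType) A B (A' B' : subgroup N) n m
    (f : {additive M -> N}) :
    (forall x, A x -> A' (f x)) -> (forall x, A x -> B' (f x) -> B x) ->
    has_qcard A B n -> has_qcard A' B' m -> (n <= m)%N.
Proof.
move=> fA fB [g [gA _ ginj]] [g' [_ g'cov _]].
have /fin_all_exists[h hP] i : exists j, B' (f (g i) - g' j).
  by apply: g'cov; apply: fA.
suff /leq_card : injective h by rewrite !card_ord.
move=> i j hij; apply: ginj; apply: fB; first exact: smemB.
rewrite raddfB -[_ - _](subrKA (g' (h i))) -[g' _ - _]opprB.
by apply: smemB => //; rewrite hij.
Qed.

Lemma has_qcard_uniq A B n m : has_qcard A B n -> has_qcard A B m -> n = m.
Proof.
move=> hn hm; apply/eqP; rewrite eqn_leq.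
have leq' k k' : has_qcard A B k -> has_qcard A B k' -> (k <= k')%N.
  exact: (has_qcard_leq (f := idfun)).
by rewrite !leq'.
Qed.

Lemma qcardP A B : finite_index A B -> has_qcard A B (qcard A B).
Proof. by move=> fAB; apply: epsilon_spec. Qed.

Lemma qcardE A B n : has_qcard A B n -> qcard A B = n.
Proof. by move=> hn; exact: has_qcard_uniq (qcardP (ex_intro _ n hn)) hn. Qed.

Lemma has_qcard_gt0 A B n : has_qcard A B n -> (0 < n)%N.
Proof.
move=> [f [_ cov _]]; have [i _] := cov 0 (smem0 A).
exact: leq_ltn_trans (ltn_ord i).
Qed.

(** Quotients are never formed: an isomorphism A/B -> A'/B' is an additive map of the ambient groups
    with these three properties. *)
Lemma has_qcard_iso (N : zmodType) A B (A' B' : subgroup N) n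
    (f : {additive M -> N}) :
    (forall x, A x -> A' (f x)) -> (forall x, A x -> B' (f x) <-> B x) ->
    (forall y, A' y -> exists2 x, A x & B' (y - f x)) ->
  has_qcard A B n <-> has_qcard A' B' n.
Proof.
move=> fA fB fsurj; split=> [[g [gA gcov ginj]]|[g [gA gcov ginj]]].
  exists (f \o g); split=> /= [i|y /fsurj[x Ax xy]|i j].
  - exact/fA.
  - have [i Bi] := gcov x Ax; exists i; rewrite -[y - _](subrKA (f x)).
    apply: smemD => //; rewrite -raddfB; apply/fB => //; exact: smemB.
  - by rewrite -raddfB => /fB h; apply/ginj/h/smemB.
have /fin_all_exists2[h hA hP] i : exists2 x, A x & B' (g i - f x) by apply/fsurj.
exists h; split=> // [a Aa|i j].
- have [i Bi] := gcov (f a) (fA _ Aa); exists i; apply/fB; first exact: smemB.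
  by rewrite raddfB -[_ - _](subrKA (g i)); apply: smemD.
- move/fB => /(_ (smemB (hA i) (hA j))); rewrite raddfB => h'; apply: ginj.
  rewrite -[_ - _](subrKA (f (h i))); apply: smemD => //.
  rewrite -[_ - _](subrKA (f (h j))) addrC; apply: smemD => //.
  by rewrite -opprB; apply/smemN.
Qed.

Lemma has_qcard_tower A B C n m : sle B A -> sle C B ->
  has_qcard A B n -> has_qcard B C m -> has_qcard A C (n * m).
Proof.
move=> BA CB [f [fA fcov finj]] [g [gB gcov ginj]].
rewrite -[n]card_ord -[m]card_ord -card_prod.
apply: (@has_qcard_fin _ _ _ (fun p : 'I_n * 'I_m => f p.1 + g p.2)).
- by move=> [i j]; apply: smemD => //; apply: BA.
- move=> a /fcov[i /gcov[j Cj]]; exists (i, j); by rewrite /= opprD addrA.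
- move=> [i j] [i' j'] /= h.
  have ii' : i = i'.
    apply: finj; rewrite -[_ - _](addrK (g j - g j')) addrACA -opprD.
    by apply: smemB; [apply: CB|apply: smemB].
  by subst i'; congr pair; apply: ginj; move: h; rewrite opprD addrACA subrr add0r.
Qed.

(** The [f i] may lie outside A and may repeat classes. A cover by elements of A of least size is
    irredundant, since one of two equivalent representatives could be dropped. *)
Lemma finite_index_cover A B (I : finType) (f : I -> M) :
  (forall a, A a -> exists i, B (a - f i)) -> finite_index A B.
Proof.
move=> cov.
pose covers n := exists2 g : 'I_n -> M, (forall i, A (g i)) &
  forall a, A a -> exists i, B (a - g i).
have ex_cov : exists n, covers n.
  (* Each [f i] is replaced by an element of A in its class, or by 0 when the class misses A. *)
  have /fin_all_exists[g hg] i : exists x, A x /\ ((exists2 a, A a & B (a - f i)) -> B (x - f i)).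
    have [[a Aa Ba]|no] := excluded_middle_informative (exists2 a, A a & B (a - f i)).
      by exists a.
    by exists 0; split=> //; apply: smem0.
  exists #|I|, (g \o enum_val) => [i|a Aa]; first by case: (hg (enum_val i)).
  have [i Bi] := cov a Aa; exists (enum_rank i); rewrite /= enum_rankK.
  have [_ /(_ (ex_intro2 _ _ a Aa Bi)) Bgi] := hg i.
  by rewrite -[a - _](subrKA (f i)) -[f i - _]opprB; apply: smemB.
have [n [[g gA gcov] nmin]] :
    exists n, covers n /\ forall m, covers m -> (n <= m)%N.
  have [n0 cn0] := ex_cov; move: cn0.
  elim/ltn_ind: n0 => n IHn cn.
  have [[m [mn cm]]|no] :=
    excluded_middle_informative (exists m, (m < n)%N /\ covers m).
    exact: IHn cm.
  by exists n; split=> // m cm; rewrite leqNgt; apply/negP => mn; apply: no; exists m.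
exists n, g; split=> // i j Bij; apply/eqP/negPn/negP => neq.
case: n g gA gcov nmin i j Bij neq => [|n] g gA gcov nmin i j Bij neq; first by case: i {Bij neq}.
suff /nmin : covers n by rewrite ltnn.
exists (g \o lift i) => [k|a Aa]; first exact: gA.
have [k Bk] := gcov a Aa.
have [eqk|neqk] := eqVneq k i.
  case: (unlift_some neq) => j' jj' _; exists j'; rewrite /= -jj'.
  by rewrite -[_ - _](subrKA (g i)) -{1}eqk; apply: smemD.
rewrite eq_sym in neqk; case: (unlift_some neqk) => k' kk' _.
by exists k'; rewrite /= -kk'.
Qed.

Lemma finite_index_sub A A' B B' : sle A' A -> sle B B' -> finite_index A B ->
  finite_index A' B'.
Proof.
move=> AA BB [n [f [fA fcov _]]]; apply: (@finite_index_cover _ _ _ f) => a /AA/fcov[i Bi].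
by exists i; apply: BB.
Qed.

Lemma finite_index_iso (N : zmodType) A B (A' B' : subgroup N)
    (f : {additive M -> N}) :
    (forall x, A x -> A' (f x)) -> (forall x, A x -> B' (f x) <-> B x) ->
    (forall y, A' y -> exists2 x, A x & B' (y - f x)) ->
  finite_index A B <-> finite_index A' B'.
Proof.
by move=> h1 h2 h3; split=> -[n /(has_qcard_iso n h1 h2 h3)hn]; exists n.
Qed.

Lemma has_qcard_prod (N : zmodType) A B (A' B' : subgroup N) n m :
  has_qcard A B n -> has_qcard A' B' m ->
  has_qcard (sprod A A') (sprod B B') (n * m).
Proof.
move=> [f [fA fcov finj]] [g [gA gcov ginj]].
rewrite -[n]card_ord -[m]card_ord -card_prod.
exists (fun k => let p := enum_val k : 'I_n * 'I_m in (f p.1, g p.2)); split=> /=.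
- by move=> k; split=> /=.
- move=> [a a'] [/= /fcov[i Bi] /gcov[j Bj]]; exists (enum_rank (i, j)).
  by rewrite enum_rankK.
- move=> i j [/= /finj h1 /ginj h2]; apply: enum_val_inj.
  by case: (enum_val i) (enum_val j) h1 h2 => [x y] [x' y'] /= -> ->.
Qed.

Lemma eq_has_qcard A B A' B' n : sle A A' -> sle A' A -> sle B B' -> sle B' B ->
  has_qcard A B n -> has_qcard A' B' n.
Proof.
move=> AA' A'A BB' B'B; apply: (has_qcard_iso n (f := idfun) _ _ _).1 => //=.
- by move=> x _; split=> [/B'B|/BB'].
- by move=> y /A'A Ay; exists y => //; rewrite subrr; apply: smem0.
Qed.

End Counting.

(** * Valuations of indices *)

Section IndexValuation.
Variable l : nat.

Definition vidx (M : zmodType) (A B : subgroup M) : nat := logn l (qcard A B).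

Lemma vidxE (M : zmodType) (A B : subgroup M) n :
  has_qcard A B n -> vidx A B = logn l n.
Proof. by move=> /qcardE; rewrite /vidx => ->. Qed.

Lemma finite_index_tower (M : zmodType) (A B C : subgroup M) :
  sle B A -> sle C B -> finite_index A B -> finite_index B C -> finite_index A C.
Proof.
by move=> BA CB [n hn] [m hm]; exists (n * m)%N; apply: has_qcard_tower hn hm.
Qed.

Lemma vidx_tower (M : zmodType) (A B C : subgroup M) :
  sle B A -> sle C B -> finite_index A C -> vidx A C = (vidx A B + vidx B C)%N.
Proof.
move=> BA CB fAC.
have [n hn] : finite_index A B by apply: finite_index_sub fAC.
have [m hm] : finite_index B C by apply: finite_index_sub fAC.
rewrite (vidxE hn) (vidxE hm) (vidxE (has_qcard_tower BA CB hn hm)).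
by rewrite lognM //; [apply: has_qcard_gt0 hn|apply: has_qcard_gt0 hm].
Qed.

Lemma vidx_iso (M N : zmodType) (A B : subgroup M) (A' B' : subgroup N)
    (f : {additive M -> N}) :
    (forall x, A x -> A' (f x)) -> (forall x, A x -> B' (f x) <-> B x) ->
    (forall y, A' y -> exists2 x, A x & B' (y - f x)) ->
  finite_index A B -> vidx A B = vidx A' B'.
Proof.
move=> h1 h2 h3 [n hn]; rewrite (vidxE hn).
by rewrite (vidxE ((has_qcard_iso n h1 h2 h3).1 hn)).
Qed.

Lemma vidx_eq (M : zmodType) (A B A' B' : subgroup M) :
    sle A A' -> sle A' A -> sle B B' -> sle B' B ->
  finite_index A B -> vidx A B = vidx A' B'.
Proof.
move=> AA' A'A BB' B'B [n hn]; rewrite (vidxE hn).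
by rewrite (vidxE (eq_has_qcard AA' A'A BB' B'B hn)).
Qed.

Lemma vidx_same (M : zmodType) (A B : subgroup M) : sle A B -> vidx A B = 0%N.
Proof.
move=> AB; rewrite (@vidxE _ _ _ 1) ?logn1 //.
exists (fun=> 0); split=> [_|a Aa|i j _]; first exact: smem0.
  by exists ord0; rewrite subr0; apply: AB.
by rewrite !ord1.
Qed.

Lemma finite_index_same (M : zmodType) (A B : subgroup M) :
  sle A B -> finite_index A B.
Proof.
move=> AB; apply: (@finite_index_cover _ _ _ 'I_1 (fun=> 0)) => a Aa.
by exists ord0; rewrite subr0; apply: AB.
Qed.

(** Lagrange: A/B is isomorphic to I/B' with I between B' and A', and the tower splits off the
    rest. *)
Lemma vidx_inj (M N : zmodType) (A B : subgroup M) (A' B' : subgroup N)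
    (f : {additive M -> N}) : sle B' A' ->
    (forall x, A x -> A' (f x)) -> (forall x, A x -> B' (f x) <-> B x) ->
  finite_index A' B' -> finite_index A B /\ (vidx A B <= vidx A' B')%N.
Proof.
move=> BA fA fB fin'; pose I := sjoin (simg f A) B'.
have IA : sle I A' by move=> _ [_ [b [[a Aa ->] Bb ->]]]; apply: smemD; [apply: fA|apply: BA].
have BI : sle B' I.
  by move=> b Bb; exists 0, b; rewrite add0r; split=> //; apply: smem0.
have AI x : A x -> I (f x).
  by move=> Ax; exists (f x), 0; rewrite addr0; split=> //; [exists x|apply: smem0].
have sI y : I y -> exists2 x, A x & B' (y - f x).
  by move=> [_ [b [[a Aa ->] Bb ->]]]; exists a; rewrite // addrC addKr.
have finI : finite_index I B' by apply: finite_index_sub fin'.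
have finA : finite_index A B by apply/(finite_index_iso AI fB sI).
split=> //; rewrite (vidx_iso AI fB sI finA).
by rewrite [leqRHS](vidx_tower IA BI fin') leq_addl.
Qed.

(** * Herbrand-type quotients *)

(** For the induced map A/A0 -> B/B0, kernel and cokernel are written as indices of subgroups of the
    ambient groups. *)
Definition coker_vidx (M N : zmodType) (f : {additive M -> N}) (A : subgroup M)
  (B B0 : subgroup N) := vidx B (sjoin (simg f A) B0).

Definition ker_vidx (M N : zmodType) (f : {additive M -> N}) (A A0 : subgroup M)
  (B0 : subgroup N) := vidx (smeet A (spre f B0)) A0.

(* [A/A0 -> B/B0] is well defined, with finite kernel and cokernel *)
Record isogeny (M N : zmodType) (f : {additive M -> N}) (A A0 : subgroup M)
    (B B0 : subgroup N) : Prop := Isogeny {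
  isog_src : sle A0 A;
  isog_tgt : sle B0 B;
  isog_map : forall x, A x -> B (f x);
  isog_map0 : forall x, A0 x -> B0 (f x);
  isog_coker : finite_index B (sjoin (simg f A) B0);
  isog_ker : finite_index (smeet A (spre f B0)) A0 }.

Definition herb (M N : zmodType) (f : {additive M -> N}) (A A0 : subgroup M)
    (B B0 : subgroup N) : int :=
  (coker_vidx f A B B0)%:Z - (ker_vidx f A A0 B0)%:Z.

Lemma sjoinl (M : zmodType) (A B : subgroup M) x : A x -> sjoin A B x.
Proof. by exists x, 0; rewrite addr0; split=> //; apply: smem0. Qed.

Lemma sjoinr (M : zmodType) (A B : subgroup M) x : B x -> sjoin A B x.
Proof. by exists 0, x; rewrite add0r; split=> //; apply: smem0. Qed.

Lemma sjoin_sub (M : zmodType) (A B C : subgroup M) :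
  sle A C -> sle B C -> sle (sjoin A B) C.
Proof. by move=> AC BC _ [a [b [/AC Ca /BC Cb ->]]]; apply: smemD. Qed.

Lemma isog_bij (M N : zmodType) (f : {additive M -> N}) (A A0 : subgroup M)
    (B B0 : subgroup N) : sle A0 A -> sle B0 B ->
    (forall x, A x -> B (f x)) -> (forall x, A0 x -> B0 (f x)) ->
    (forall x, A x -> B0 (f x) -> A0 x) ->
    (forall y, B y -> exists2 x, A x & B0 (y - f x)) ->
  isogeny f A A0 B B0 /\ herb f A A0 B B0 = 0.
Proof.
move=> hA hB fA fA0 fi fs.
have hc : sle B (sjoin (simg f A) B0).
  by move=> y /fs[x Ax Bx]; exists (f x), (y - f x); rewrite subrKC; split=> //; exists x.
have hk : sle (smeet A (spre f B0)) A0 by move=> x [Ax Bx]; apply: fi.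
split; first by split=> //; apply: finite_index_same.
by rewrite /herb /coker_vidx /ker_vidx !vidx_same.
Qed.

Section Composition.
Variables (M N P : zmodType) (f : {additive M -> N}) (g : {additive N -> P}).
Variables (A A0 : subgroup M) (B B0 : subgroup N) (C C0 : subgroup P).
Hypotheses (fi : isogeny f A A0 B B0) (gi : isogeny g B B0 C C0).

(** The exact sequence 0 -> ker f -> ker gf -> ker g -> coker f -> coker gf -> coker g -> 0, cut at
    its inner terms: [i3] is the image in ker g, [i2] the image in coker f, [i1] the image in coker
    gf. *)
Lemma herb_comp :
  isogeny (g \o f) A A0 C C0 /\
  herb (g \o f) A A0 C C0 = herb g B B0 C C0 + herb f A A0 B B0.
Proof.
case: fi gi => A0A B0B fA fA0 fcok fker [_ C0C gB gB0 gcok gker].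
pose K := smeet B (spre g C0).
pose S1 := sjoin (simg g B) C0.
pose S2 := sjoin (simg (g \o f) A) C0.
pose FK := sjoin (simg f A) K.
pose FB := sjoin (simg f A) B0.
pose KF := smeet K FB.
pose KA := smeet A (spre (g \o f) C0).
pose Kf := smeet A (spre f B0).
have imB : sle (simg f A) B by move=> _ [x /fA Bx ->].
have S1C : sle S1 C by apply: sjoin_sub => // _ [x /gB Cx ->].
have S21 : sle S2 S1.
  apply: sjoin_sub; last by move=> x; apply: sjoinr.
  by move=> _ [x /fA Bx ->]; apply: sjoinl; exists (f x).
have FKB : sle FK B by apply: sjoin_sub => // x [].
have B0K : sle B0 K by move=> x B0x; split; [apply: B0B|apply: gB0].
have FBK : sle FB FK.
  by apply: sjoin_sub => x; [apply: sjoinl|move=> /B0K; apply: sjoinr].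
have KFK : sle KF K by move=> x [].
have B0KF : sle B0 KF by move=> x hx; split; [apply: B0K|apply: sjoinr].
have KfKA : sle Kf KA by move=> x [Ax Bx]; split=> //=; apply: gB0.
have A0Kf : sle A0 Kf by move=> x hx; split; [apply: A0A|apply: fA0].
have i1 : (forall x, B x -> S1 (g x)) /\ (forall x, B x -> S2 (g x) <-> FK x) /\
    (forall y, S1 y -> exists2 x, B x & S2 (y - g x)).
  split=> [x Bx|]; first by apply: sjoinl; exists x.
  split=> [x Bx|_ [_ [c [[x Bx ->] Cc ->]]]].
    split=> [[_ [c [[a Aa ->] Cc e]]]|[_ [k [[a Aa ->] [Bk Ck] ->]]]].
      exists (f a), (x - f a); rewrite subrKC; split=> //; first by exists a.
      split; first by apply: smemB => //; apply: fA.
      by rewrite /= raddfB e addrC addKr.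
    by rewrite raddfD; exists (g (f a)), (g k); split=> //; exists a.
  by exists x => //; rewrite addrC addKr; apply: sjoinr.
have i2 : (forall x, K x -> FK (idfun x)) /\ (forall x, K x -> FB (idfun x) <-> KF x) /\
    (forall y, FK y -> exists2 x, K x & FB (y - idfun x)).
  split=> [x|]; first exact: sjoinr.
  split=> [x Kx|_ [x [k [Ax Kk ->]]]]; first by split=> // -[].
  by exists k => //; rewrite (addrK k x); apply: sjoinl.
have i3 : (forall x, KA x -> KF (f x)) /\ (forall x, KA x -> B0 (f x) <-> Kf x) /\
    (forall y, KF y -> exists2 x, KA x & B0 (y - f x)).
  split=> [x [Ax Cx]|].
    split; first by split=> [|//]; apply: fA.
    by apply: (@sjoinl _ (simg f A)); exists x.
  split=> [x [Ax Cx]|y [[By Cy] [_ [b [[a Aa ->] B0b e]]]]]; first by split=> // -[].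
  exists a; last by rewrite e addrC addKr.
  split=> //=; have -> : f a = y - b by rewrite e addrK.
  by rewrite raddfB; apply: smemB => //; apply: gB0.
case: i1 i2 i3 => [a1 [a2 a3]] [b1 [b2 b3]] [c1 [c2 c3]].
have finS : finite_index S1 S2.
  by apply/(finite_index_iso a1 a2 a3); apply: finite_index_sub fcok.
have finKA : finite_index KA Kf.
  by apply/(finite_index_iso c1 c2 c3); apply: finite_index_sub gker.
have finC : finite_index C S2 by apply: finite_index_tower gcok finS.
have finA : finite_index KA A0 by apply: finite_index_tower finKA fker.
split; first split=> //; first by move=> x Ax; apply/gB/fA.
  by move=> x Ax; apply/gB0/fA0.
rewrite /herb /coker_vidx /ker_vidx.
rewrite -/S1 -/S2 -/KA -/Kf -/FB -/K.
have e1 := vidx_tower S1C S21 finC.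
have e2 := vidx_iso a1 a2 a3 (finite_index_sub (@sle_refl _ B) FBK fcok).
have e3 := vidx_tower FKB FBK fcok.
have e4 := vidx_iso b1 b2 b3 (finite_index_sub (@sle_refl _ K) B0KF gker).
have e5 := vidx_tower KFK B0KF gker.
have e6 := vidx_tower KfKA A0Kf finA.
have e7 := vidx_iso c1 c2 c3 finKA.
lia.
Qed.

End Composition.

Section Filtration.
Variables (M N : zmodType) (f : {additive M -> N}).
Variables (A A0 Z : subgroup M) (B B0 Z' : subgroup N).
Hypotheses (A0A : sle A0 A) (B0B : sle B0 B).
Hypotheses (fi : isogeny f A Z B Z') (fi0 : isogeny f A0 Z B0 Z').

(** The snake lemma for the subgroup A0/Z of A/Z with quotient A/A0. The connecting map is [i2],
    from KB/J onto BI/I0; [i3] and [i1] are the images of the kernel and cokernel sequences at the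
    middle. Finiteness for A/A0 is a consequence. *)
Lemma herb_filtration :
  isogeny f A A0 B B0 /\
  herb f A Z B Z' = herb f A0 Z B0 Z' + herb f A A0 B B0.
Proof.
case: fi fi0 => _ ZB fA fZ fcok fker [ZA0 ZB0 fA0 _ fcok0 fker0].
pose I := sjoin (simg f A) Z'.
pose IB := sjoin (simg f A) B0.
pose I0 := sjoin (simg f A0) Z'.
pose BI := smeet B0 I.
pose KB := smeet A (spre f B0).
pose K := smeet A (spre f Z').
pose K0 := smeet A0 (spre f Z').
pose J := sjoin A0 K.
have IIB : sle I IB.
  by apply: sjoin_sub => x; [apply: sjoinl|move=> /ZB0; apply: sjoinr].
have IBB : sle IB B by apply: sjoin_sub => // _ [x /fA Bx ->].
have BIB : sle BI B0 by move=> x [].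
have I0BI : sle I0 BI.
  apply: sjoin_sub => [_ [x A0x ->]|x Zx]; split; [exact: fA0| |exact: ZB0|exact: sjoinr].
  by apply: sjoinl; exists x => //; apply: A0A.
have K0K : sle K0 K by move=> x [/A0A].
have ZK0 : sle Z K0 by move=> x hx; split; [apply: ZA0|apply: fZ].
have A0J : sle A0 J by move=> x; apply: sjoinl.
have JKB : sle J KB.
  apply: sjoin_sub => [x A0x|x [Ax Zx]]; split; [exact: A0A|exact: fA0|by []|].
  exact: ZB0.
have i1 : (forall x, B0 x -> IB (idfun x)) /\ (forall x, B0 x -> I (idfun x) <-> BI x) /\
    (forall y, IB y -> exists2 x, B0 x & I (y - idfun x)).
  split=> [x|]; first exact: sjoinr.
  split=> [x Kx|_ [x [k [Ax Kk ->]]]]; first by split=> // -[].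
  by exists k => //; rewrite (addrK k x); apply: sjoinl.
have i2 : (forall x, KB x -> BI (f x)) /\ (forall x, KB x -> I0 (f x) <-> J x) /\
    (forall y, BI y -> exists2 x, KB x & I0 (y - f x)).
  split=> [x [Ax Bx]|]; first by split=> //; apply: sjoinl; exists x.
  split=> [x [Ax Bx]|y [By [_ [z [[a Aa ->] Zz e]]]]].
    split=> [[_ [z [[a A0a ->] Zz e]]]|[a [k [A0a [Ak Zk] ->]]]].
      exists a, (x - a); rewrite subrKC; split=> //.
      split; first by apply: smemB => //; apply: A0A.
      by rewrite /= raddfB e addrC addKr.
    by rewrite raddfD; exists (f a), (f k); split=> //; exists a.
  exists a; last by rewrite e addrC addKr; apply: sjoinr.
  split=> //=; have -> : f a = y - z by rewrite e addrK.
  by apply: smemB => //; apply: ZB0.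
have i3 : (forall x, K x -> J (idfun x)) /\ (forall x, K x -> A0 (idfun x) <-> K0 x) /\
    (forall y, J y -> exists2 x, K x & A0 (y - idfun x)).
  split=> [x|]; first exact: sjoinr.
  split=> [x [Ax Zx]|_ [x [k [Ax Kk ->]]]]; first by split=> // -[].
  by exists k => //; rewrite (addrK k x).
case: i1 i2 i3 => [a1 [a2 a3]] [b1 [b2 b3]] [c1 [c2 c3]].
have finJ : finite_index J A0.
  by apply/(finite_index_iso c1 c2 c3); apply: finite_index_sub fker.
have finKJ : finite_index KB J.
  by apply/(finite_index_iso b1 b2 b3); apply: finite_index_sub fcok0.
have finKB : finite_index KB A0 by apply: finite_index_tower finKJ finJ.
have finB : finite_index B IB by apply: finite_index_sub fcok.
split; first by split.
rewrite /herb /coker_vidx /ker_vidx -/I -/IB -/I0 -/KB -/K -/K0.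
have e1 := vidx_tower IBB IIB fcok.
have e2 := vidx_iso a1 a2 a3 (finite_index_sub (@sle_refl _ B0) I0BI fcok0).
have e3 := vidx_tower BIB I0BI fcok0.
have e4 := vidx_iso b1 b2 b3 finKJ.
have e5 := vidx_tower JKB A0J finKB.
have e6 := vidx_iso c1 c2 c3 (finite_index_sub (@sle_refl _ K) ZK0 fker).
have e7 := vidx_tower K0K ZK0 fker.
lia.
Qed.

End Filtration.

End IndexValuation.

(** * Finitely generated groups *)

Definition zfg (M : zmodType) := exists n (g : 'I_n -> M),
  forall m, exists c : 'I_n -> int, m = \sum_i g i *~ c i.

Definition lincomb (M : zmodType) n (g : 'I_n -> M) (c : 'rV[int]_n) : M :=
  \sum_i g i *~ c 0 i.

Lemma lincomb_is_zmod_morphism (M : zmodType) n (g : 'I_n -> M) :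
  zmod_morphism (lincomb g).
Proof.
move=> c d; rewrite /lincomb -sumrB; apply: eq_bigr => i _.
by rewrite !mxE mulrzDr mulrNz.
Qed.

HB.instance Definition _ (M : zmodType) n (g : 'I_n -> M) :=
  GRing.isZmodMorphism.Build 'rV[int]_n M (lincomb g) (lincomb_is_zmod_morphism g).

Definition szspan (M : zmodType) n (g : 'I_n -> M) :=
  simg (lincomb g) (sfull 'rV[int]_n).

Lemma szspanP (M : zmodType) n (g : 'I_n -> M) x :
  szspan g x <-> exists c : 'I_n -> int, x = \sum_i g i *~ c i.
Proof.
split=> [[c _ ->]|[c ->]]; first by exists (c 0).
exists (\row_i c i) => //=; rewrite /lincomb.
by apply: eq_bigr => i _; rewrite mxE.
Qed.

(* Noetherianity is only needed in this form; induction on the number of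
   generators, through the ideal of first coordinates of [C] *)
Lemma finite_index_span (M : zmodType) k (g : 'I_k -> M) (C : subgroup M) n :
  (0 < n)%N -> sle C (szspan g) -> finite_index C (snmul n C).
Proof.
move=> n0; elim: k g C => [|k IHk] g C Cg.
  apply: finite_index_same => x /Cg/szspanP[c ->].
  by rewrite big_ord0; apply: smem0.
pose g' := g \o lift ord0; pose D := smeet C (szspan g').
have finD : finite_index D (snmul n D) by apply: (IHk g') => x [].
pose E := sjoin (snmul n C) D.
have nCC : sle (snmul n C) C by move=> _ [x [Cx ->]]; apply: smemMn.
have DC : sle D C by move=> x [].
have EC : sle E C by apply: sjoin_sub.
have nCE : sle (snmul n C) E by move=> x; apply: sjoinl.
have finE : finite_index E (snmul n C).
  case: finD => m [f [fD fcov _]].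
  apply: (@finite_index_cover _ _ _ _ f) => _ [x [y [nx /fcov[i [z [Dz e]]] ->]]].
  exists i; rewrite -addrA; apply: smemD => //; exists z; split=> //; exact: DC.
(* The generators may satisfy relations, so an element can have several first coordinates; [I] is an
   ideal all the same. *)
pose I (a : int) := exists2 c, C c & szspan g' (c - g ord0 *~ a).
have coordI c : C c -> exists a, I a /\ szspan g' (c - g ord0 *~ a).
  move=> Cc; have [v cv] := (szspanP _ _).1 (Cg _ Cc); exists (v ord0).
  suff h : szspan g' (c - g ord0 *~ v ord0) by split=> //; exists c.
  rewrite cv big_ord_recl addrC addKr.
  by apply/szspanP; exists (fun i => v (lift ord0 i)).
have IMz a m : I a -> I (a *~ m).
  move=> [c Cc hc]; exists (c *~ m); first exact: smemMz.
  by rewrite mulrzz mulrzA -mulrzBl; apply: smemMz.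
have IB a b : I a -> I b -> I (a - b).
  move=> [c Cc hc] [d Cd hd]; exists (c - d); first exact: smemB.
  by move: (smemB hc hd); rewrite mulrzBr !opprD !opprK addrACA.
suff finC : finite_index C E by apply: finite_index_tower finC finE.
have [[p [p0 Ip pmin]]|no] := excluded_middle_informative
   (exists p, [/\ (0 < p)%N, I p%:Z & forall p', (0 < p')%N -> I p'%:Z -> (p <= p')%N]); last first.
  apply: finite_index_same => c Cc; apply: sjoinr; split=> //.
  have [a [Ia]] := coordI _ Cc.
  suff -> : a = 0 by rewrite mulr0z subr0.
  apply/eqP/negPn/negP => a0; case: no.
  have Iabs : I `|a|%N%:Z.
    rewrite abszE; have [a_ge|a_lt] := lerP 0 a; first by rewrite ger0_norm.
    by rewrite ltr0_norm // -[a]mulr1z -mulrNz; apply: IMz.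
  have : (0 < `|a|)%N by rewrite absz_gt0.
  move: `|a|%N Iabs => m; elim/ltn_ind: m => m IHm Im m0.
  have [[p [pm p0 Ip]]|no] := excluded_middle_informative
      (exists p, [/\ (p < m)%N, (0 < p)%N & I p%:Z]).
    exact: IHm Ip p0.
  exists m; split=> // p p0 Ip; rewrite leqNgt; apply/negP => pm.
  by apply: no; exists p.
case: Ip (Ip) => c0 Cc0 hc0 Ip.
(* The first coordinate of [c0] generates [I], so [c0] generates C modulo D, and its first n
   multiples represent C modulo nC + D. *)
apply: (@finite_index_cover _ _ _ 'I_n (fun i => c0 *+ i)) => c Cc.
have [a [Ia ha]] := coordI _ Cc.
have p_neq0 : p%:Z != 0 by rewrite eqz_nat -lt0n.
have pa : (a %% p)%Z = 0.
  have := modz_ge0 a p_neq0; have := ltz_mod a p_neq0.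
  have : I (a %% p)%Z.
    rewrite [X in I X](_ : _ = a - p%:Z *~ (a %/ p)%Z); first by apply: IB => //; apply: IMz.
    by rewrite {2}(divz_eq a p) mulrzz mulrC addrC addKr.
  case: (a %% p)%Z => // [[|m]] // /(pmin m.+1 isT); rewrite ger0_norm // => h1.
  by rewrite ltz_nat ltnNge h1.
have n_neq0 : n%:Z != 0 by rewrite eqz_nat -lt0n.
pose k1 := (a %/ p)%Z.
have := modz_ge0 k1 n_neq0; have := ltz_mod k1 n_neq0.
rewrite ger0_norm //; case er : (k1 %% n)%Z => [r|r] // rn _.
have {}rn : (r < n)%N by [].
exists (Ordinal rn); change (E (c - c0 *+ r)).
have -> : c - c0 *+ r = (c0 *~ (k1 %/ n)%Z) *+ n + (c - c0 *~ k1).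
  have ek : k1 = (k1 %/ n)%Z * n%:Z + r%:Z by rewrite {1}(divz_eq k1 n) er.
  rewrite {2}ek mulrzDr mulrzA !pmulrn.
  by rewrite [RHS]addrC opprD [- _ - _]addrC addrA subrK.
apply: smemD.
  by apply: sjoinl; exists (c0 *~ (k1 %/ n)%Z); split=> //; apply: smemMz.
apply: sjoinr; split; first by apply: smemB => //; apply: smemMz.
have ea : a = p%:Z * k1 by rewrite {1}(divz_eq a p) pa addr0 mulrC.
rewrite -[c - _](subrKA (g ord0 *~ a)); apply: smemD => //.
rewrite {1}ea mulrzA -mulrzBl; apply: smemMz.
by rewrite -opprB; apply: smemN.
Qed.

(** The source of finiteness below: C/B is a quotient of C/nC, which is finite. *)
Lemma zfg_finite_index (M : zmodType) (C B : subgroup M) n : zfg M -> (0 < n)%N ->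
  (forall x, C x -> B (x *+ n)) -> finite_index C B.
Proof.
move=> [k [g gM]] n0 CB.
apply: (@finite_index_sub _ C _ (snmul n C)) => //; first by move=> _ [x [Cx ->]]; apply: CB.
apply: (finite_index_span (g := g)) => // x _.
by have [c ->] := gM x; apply/szspanP; exists c.
Qed.

Lemma is_tors0 (M : zmodType) : is_tors (0 : M).
Proof. by exists 1%N; rewrite mul0rn. Qed.

Lemma is_torsP (M : zmodType) (x : M) : is_tors x <-> stors (sfull M) x.
Proof. by split=> [|[]]. Qed.

Lemma is_torsD (M : zmodType) (x y : M) : is_tors x -> is_tors y -> is_tors (x + y).
Proof. by rewrite !is_torsP; apply: smemD. Qed.

Lemma is_torsB (M : zmodType) (x y : M) : is_tors x -> is_tors y -> is_tors (x - y).
Proof. by rewrite !is_torsP; apply: smemB. Qed.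

Lemma is_torsMz (M : zmodType) (x : M) z : is_tors x -> is_tors (x *~ z).
Proof. by rewrite !is_torsP; apply: smemMz. Qed.

Lemma is_tors_sum (M : zmodType) (I : finType) (F : I -> M) :
  (forall i, is_tors (F i)) -> is_tors (\sum_i F i).
Proof. by move=> h; apply/is_torsP/smem_sum => i; apply/is_torsP. Qed.

Lemma is_tors_map (M N : zmodType) (f : {additive M -> N}) x :
  is_tors x -> is_tors (f x).
Proof. by move=> [n [n0 e]]; exists n; rewrite -raddfMn e raddf0. Qed.

Lemma tors_finite (M : zmodType) n (b : 'I_n -> M) : zfg M ->
  tf_basis (fun=> True) b -> forall A : subgroup M, finite_index (stors A) (szero M).
Proof.
move=> fgM; case: (fgM) => k [g gM] [_ bspan bfree] A.
have /fin_all_exists[c hc] i := bspan (g i) I.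
pose t i := g i - \sum_j b j *~ c i j.
have /fin_all_exists[e he] : forall i, exists m, (0 < m)%N /\ t i *+ m = 0 by [].
(* [E] kills the torsion part of every generator, hence every torsion element, whose coordinates on
   the basis vanish. *)
pose E := (\prod_i e i)%N.
have E0 : (0 < E)%N by rewrite prodn_gt0 // => i; have [] := he i.
apply: (zfg_finite_index fgM E0) => x [tx _] /=.
have [a xa] := gM x.
have xE : x = \sum_j b j *~ (\sum_i c i j * a i) + \sum_i t i *~ a i.
  rewrite {1}xa; transitivity (\sum_i \sum_j b j *~ (c i j * a i) + \sum_i t i *~ a i).
    rewrite -big_split; apply: eq_bigr => i _ /=.
    rewrite [X in X + _](_ : _ = (\sum_j b j *~ c i j) *~ a i); last first.
      by rewrite mulrz_suml; apply: eq_bigr => j _; rewrite mulrzA.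
    by rewrite -mulrzDl /t subrKC.
  congr (_ + _); rewrite exchange_big; apply: eq_bigr => j _.
  by rewrite -mulrz_sumr.
have tE i : t i *+ E = 0.
  by rewrite /E (bigD1 i) //= mulrnA; have [_ ->] := he i; rewrite mul0rn.
have c0 : forall j, \sum_i c i j * a i = 0.
  apply: bfree; rewrite -[X in is_tors X](addrK (\sum_i t i *~ a i)) -xE.
  by apply: is_torsB => //; apply: is_tors_sum => i; apply: is_torsMz; exists E.
rewrite xE big1 ?add0r; last by move=> j _; rewrite c0 mulr0z.
by rewrite -sumrMnl big1 // => i _; rewrite pmulrn mulrzAC -pmulrn tE mul0rz.
Qed.

(** * The index of the image of an integer matrix *)

Definition rowmul m n (F : 'M[int]_(m, n)) (x : 'rV[int]_m) : 'rV[int]_n := x *m F.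

Lemma rowmul_is_zmod_morphism m n (F : 'M[int]_(m, n)) : zmod_morphism (rowmul F).
Proof. by move=> x y; apply: mulmxBl. Qed.

HB.instance Definition _ m n (F : 'M[int]_(m, n)) :=
  GRing.isZmodMorphism.Build 'rV[int]_m 'rV[int]_n (rowmul F) (rowmul_is_zmod_morphism F).

Definition rowimg m n (F : 'M[int]_(m, n)) := simg (rowmul F) (sfull 'rV[int]_m).

Lemma rowimgP m n (F : 'M[int]_(m, n)) y : rowimg F y <-> exists x, y = x *m F.
Proof. by split=> [[x _ ->]|[x ->]]; exists x. Qed.

Lemma rowimg_diag n (d : 'rV[int]_n) : (forall i, d 0 i != 0) ->
  has_qcard (sfull _) (rowimg (diag_mx d)) `|\det (diag_mx d)|%N.
Proof.
move=> d0.
pose I := {dffun forall i : 'I_n, 'I_(absz (d 0 i))}.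
have -> : `|\det (diag_mx d)|%N = #|{: I}|.
  rewrite det_diag card_dep_ffun foldrE big_map -/(index_enum 'I_n).
  rewrite (big_morph absz abszM absz1) big_enum /=.
  by apply: eq_bigr => i _; rewrite card_ord.
apply: (@has_qcard_fin _ _ _ _ (fun f : I => \row_i (f i : nat)%:Z)) => // [a _|f g].
  have lt i : (absz (a ord0 i %% d ord0 i)%Z < absz (d ord0 i))%N.
    by rewrite -ltz_nat !abszE (ger0_norm (modz_ge0 _ (d0 i))) ltz_mod.
  exists [ffun i => Ordinal (lt i)]; apply/rowimgP.
  exists (\row_i (a ord0 i %/ d ord0 i)%Z); apply/rowP => i.
  rewrite mul_mx_diag !mxE ffunE /= abszE (ger0_norm (modz_ge0 _ (d0 i))).
  by rewrite {1}(divz_eq (a 0 i) (d 0 i)) addrK.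
move=> /rowimgP[x /rowP e]; apply/ffunP => i; apply/val_inj/eqP.
have := e i; rewrite mul_mx_diag !mxE => ei.
have [lf lg] := (ltn_ord (f i), ltn_ord (g i)).
have : (d ord0 i %| (f i : nat)%:Z - (g i : nat)%:Z)%Z by rewrite ei dvdz_mull.
rewrite -eqz_mod_dvd => /eqP h; rewrite -eqz_nat; apply/eqP.
have small (k : 'I_(absz (d 0 i))) : ((k : nat)%:Z %% d ord0 i)%Z = (k : nat)%:Z.
  by rewrite -modz_abs modz_small //= ltz_nat; apply: ltn_ord.
by rewrite -[LHS]small -[RHS]small.
Qed.

(** By the Smith normal form. The left unimodular factor preserves the row lattice, the right one
    moves it by an automorphism of Z^n, and neither changes the absolute determinant. *)
Lemma rowimg_det n (F : 'M[int]_n) : \det F != 0 ->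
  has_qcard (sfull _) (rowimg F) `|\det F|%N.
Proof.
have [U Uu [V Vu [d _ ->]]] := int_Smith_normal_form F.
have -> : \matrix_(i < n, j < n) (d`_i *+ (i == j :> nat)) = diag_mx (\row_i d`_i).
  by apply/matrixP => i j; rewrite !mxE.
set D := diag_mx _ => det0.
have absdet (W : 'M[int]_n) : W \in unitmx -> `|\det W|%N = 1%N.
  move=> Wu; have /eqP := congr1 (absz \o determinant) (mulmxV Wu).
  by rewrite /= det_mulmx abszM det1 muln_eq1 => /andP[/eqP].
have d0 i : (\row_i d`_i : 'rV[int]_n) 0 i != 0.
  apply: contraNneq det0 => di; rewrite !det_mulmx /D det_diag (bigD1 i) //= di.
  by rewrite mul0r mulr0 mul0r.
rewrite !det_mulmx !abszM (absdet U) // (absdet V) // mul1n muln1.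
move: (rowimg_diag d0); apply: (has_qcard_iso _ (f := rowmul V) _ _ _).1 => //=.
- move=> x _; split=> /rowimgP[y e]; apply/rowimgP.
    exists (y *m U); apply: (can_inj (mulmxK Vu)); rewrite [LHS]e.
    by rewrite !mulmxA.
  exists (y *m invmx U); rewrite [LHS]/rowmul e !mulmxA.
  by rewrite mulmxKV.
- move=> y _; exists (y *m invmx V) => //.
  by rewrite [rowmul _ _]mulmxKV // subrr; apply: (smem0 (rowimg _)).
Qed.

Section HerbDet.
Variable l : nat.

(** For finite groups |coker| / |ker| does not depend on the map: the image is counted in the source
    and in the target. *)
Lemma herb_finite (M N : zmodType) (f : {additive M -> N}) (A A0 : subgroup M)
    (B B0 : subgroup N) : sle A0 A -> sle B0 B ->
    (forall x, A x -> B (f x)) -> (forall x, A0 x -> B0 (f x)) ->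
    finite_index A A0 -> finite_index B B0 ->
  isogeny f A A0 B B0 /\ herb l f A A0 B B0 = (vidx l B B0)%:Z - (vidx l A A0)%:Z.
Proof.
move=> A0A B0B fA fA0 finA finB.
pose I := sjoin (simg f A) B0; pose K := smeet A (spre f B0).
have IB : sle I B by apply: sjoin_sub => // _ [x /fA Bx ->].
have B0I : sle B0 I by move=> x; apply: sjoinr.
have KA : sle K A by move=> x [].
have A0K : sle A0 K by move=> x A0x; split; [apply: A0A|apply: fA0].
have finBI : finite_index B I by apply: finite_index_sub finB.
have finKA : finite_index K A0 by apply: finite_index_sub finA.
split; first by split.
have AI x : A x -> I (f x) by move=> Ax; apply: sjoinl; exists x.
have AK x : A x -> B0 (f x) <-> K x by move=> Ax; split=> // -[].
have sI y : I y -> exists2 x, A x & B0 (y - f x).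
  by move=> [_ [b [[a Aa ->] Bb ->]]]; exists a => //; rewrite addrC addKr.
have e1 := vidx_iso l AI AK sI (finite_index_sub (@sle_refl _ A) A0K finA).
have e2 := vidx_tower l IB B0I finB.
have e3 := vidx_tower l KA A0K finA.
rewrite /herb /coker_vidx /ker_vidx -/I -/K.
lia.
Qed.

Lemma lincombE (M : zmodType) n (g : 'I_n -> M) c :
  lincomb g c = \sum_i g i *~ c 0 i.
Proof. by []. Qed.

Lemma lincomb_mul (M : zmodType) m n (g : 'I_n -> M) (c : 'rV[int]_m) (F : 'M[int]_(m, n)) :
  lincomb g (c *m F) = \sum_i (\sum_j g j *~ F i j) *~ c 0 i.
Proof.
under eq_bigr do rewrite mulrz_suml.
rewrite exchange_big; apply: eq_bigr => j _ /=.
by rewrite mxE mulrz_sumr; apply: eq_bigr => i _; rewrite mulrC mulrzA.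
Qed.

(** Filter by torsion. The torsion subgroups contribute the ratio of their orders; on the
    torsion-free quotients [f] is injective, with cokernel Z^n modulo the rows of F. *)
Lemma herb_det (M N : zmodType) (A : subgroup M) (B : subgroup N) n
    (a : 'I_n -> M) (b : 'I_n -> N) (F : 'M[int]_n) (f : {additive M -> N}) :
    tf_basis A a -> tf_basis B b -> (forall x, A x -> B (f x)) ->
    (forall i, is_tors (f (a i) - \sum_j b j *~ F i j)) -> \det F != 0 ->
    finite_index (stors A) (szero M) -> finite_index (stors B) (szero N) ->
    isogeny f A (szero M) B (szero N) ->
  herb l f A (szero M) B (szero N) =
    (logn l `|\det F|)%:Z + (vidx l (stors B) (szero N))%:Z
      - (vidx l (stors A) (szero M))%:Z.
Proof.
move=> [Aa aspan afree] [Bb bspan bfree] fA hF F0 finA finB fi.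
have tA : sle (stors A) A by move=> x [].
have tB : sle (stors B) B by move=> x [].
have ft x : stors A x -> stors B (f x).
  by move=> [tx Ax]; split; [apply: is_tors_map|apply: fA].
have z0 (K : zmodType) (C : subgroup K) : sle (szero K) C by move=> x ->; apply: smem0.
have f0 x : szero M x -> szero N (f x) by move=> -> /=; rewrite raddf0.
have [fi0 h0] := herb_finite (z0 _ _) (z0 _ _) ft f0 finA finB.
have [fi1 ->] := herb_filtration l tA tB fi fi0.
rewrite h0.
have flin (c : 'rV[int]_n) : is_tors (f (lincomb a c) - lincomb b (c *m F)).
  rewrite lincomb_mul raddf_sum -sumrB; apply: is_tors_sum => i.
  by rewrite raddfMz -mulrzBl; apply: is_torsMz.
have alin x : A x -> exists c : 'rV[int]_n, is_tors (x - lincomb a c).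
  move=> /aspan[c hc]; exists (\row_i c i); rewrite lincombE.
  by under eq_bigr do rewrite mxE.
have blin y : B y -> exists c : 'rV[int]_n, is_tors (y - lincomb b c).
  move=> /bspan[c hc]; exists (\row_i c i); rewrite lincombE.
  by under eq_bigr do rewrite mxE.
have bfree' (c : 'rV[int]_n) : is_tors (lincomb b c) -> c = 0.
  by move=> /bfree h; apply/rowP => i; rewrite h mxE.
have Alin c : A (lincomb a c) by apply: smem_sum => i; apply: smemMz.
have Blin c : B (lincomb b c) by apply: smem_sum => i; apply: smemMz.
have ker0 : ker_vidx l f A (stors A) (stors B) = 0%N.
  apply: vidx_same => x [Ax [tfx _]]; split=> //.
  have [c tc] := alin x Ax.
  have : is_tors (lincomb b (c *m F)).
    rewrite -[lincomb _ _](subKr (f (lincomb a c))); apply: is_torsB => //.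
    rewrite -[f _](subKr (f x)) -raddfB; apply: is_torsB => //.
    exact: is_tors_map.
  move=> /bfree' cF; have c0 : c = 0.
    have := congr1 (mulmx^~ (\adj F)) cF; rewrite -mulmxA mul_mx_adj mul0mx mul_mx_scalar.
    move=> /rowP h; apply/rowP => i; have := h i; rewrite !mxE => /eqP.
    by rewrite mulf_eq0 (negPf F0) => /eqP.
  by move: tc; rewrite c0 raddf0 subr0.
have cok : coker_vidx l f A B (stors B) = logn l `|\det F|.
  rewrite /coker_vidx -(vidxE l (rowimg_det F0)); symmetry.
  apply: (vidx_iso l (f := lincomb b)) => [x _|x _|y By|]; first exact: Blin.
  - split=> [[_ [t [[z Az ->] [tt _] e]]]|/rowimgP[c ->]].
      have [c tc] := alin z Az; apply/rowimgP; exists c; apply/eqP.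
      rewrite -subr_eq0; apply/eqP/bfree'; rewrite raddfB e.
      rewrite [f z + t]addrC -addrA; apply: is_torsD => //.
      rewrite -(subrKA (f (lincomb a c))) -raddfB; apply: is_torsD => //.
      exact: is_tors_map.
    exists (f (lincomb a c)), (lincomb b (c *m F) - f (lincomb a c)).
    rewrite subrKC; split=> //; first by exists (lincomb a c).
    split; last by apply: smemB => //; apply: fA.
    by rewrite -opprB -mulrN1z; apply: is_torsMz.
  - have [c tc] := blin y By; exists c => //; apply: sjoinr; split=> //.
    by apply: smemB => //; apply: Blin.
  - exact: ex_intro (rowimg_det F0).
by rewrite /herb ker0 cok subr0; ring.
Qed.

End HerbDet.

(** * Matrices of homomorphisms and adjoint pairs *)

Lemma additive_zmod_morphism (M N : zmodType) (f : M -> N) :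
  (forall x y, f (x + y) = f x + f y) -> zmod_morphism f.
Proof.
move=> fD x y; have f0 : f 0 = 0 by apply: (addrI (f 0)); rewrite -fD !addr0.
have fN z : f (- z) = - f z by apply/eqP; rewrite -addr_eq0 -fD addNr f0.
by rewrite fD fN.
Qed.

Definition to_additive (M N : zmodType) (f : M -> N)
    (fD : forall x y, f (x + y) = f x + f y) : {additive M -> N} :=
  HB.pack f (GRing.isZmodMorphism.Build M N f (additive_zmod_morphism fD)).

Section MapMatrix.
Variables (M N : zmodType) (f : {additive M -> N}).
Variables (n m : nat) (a : 'I_n -> M) (b : 'I_m -> N).

Definition is_mx_of (F : 'M[int]_(n, m)) :=
  forall i, is_tors (f (a i) - \sum_j b j *~ F i j).

Lemma is_mx_of_lincomb F c : is_mx_of F ->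
  is_tors (f (lincomb a c) - lincomb b (c *m F)).
Proof.
move=> hF; rewrite lincomb_mul raddf_sum -sumrB; apply: is_tors_sum => i.
by rewrite raddfMz -mulrzBl; apply: is_torsMz.
Qed.

Lemma is_mx_of_exists (A : M -> Prop) (B : subgroup N) :
  (forall i, A (a i)) -> tf_basis B b -> (forall x, A x -> B (f x)) ->
  exists F, is_mx_of F.
Proof.
move=> Aa [_ bspan _] fA.
have /fin_all_exists[c hc] i := bspan _ (fA _ (Aa i)).
exists (\matrix_(i, j) c i j) => i.
by under eq_bigr do rewrite mxE.
Qed.

End MapMatrix.

Lemma is_mx_of_scal (M N : zmodType) (f : {additive M -> N}) (g : {additive N -> M})
    n m (a : 'I_n -> M) (b : 'I_m -> N) F G (A : M -> Prop) Q :
    tf_basis A a -> is_mx_of f a b F -> is_mx_of g b a G ->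
    (forall x, A x -> g (f x) = x *+ Q) -> F *m G = (Q%:Z)%:M.
Proof.
move=> [Aa _ afree] hF hG gf; apply/row_matrixP => i; rewrite !rowE.
set x := delta_mx 0 i; apply/eqP; rewrite -subr_eq0; apply/eqP/rowP => j.
rewrite [RHS]mxE; move: j; apply: afree; rewrite -lincombE raddfB /=.
have ax : lincomb a x = a i.
  rewrite lincombE (bigD1 i) //= mxE !eqxx mulr1z big1 ?addr0 // => j ji.
  by rewrite mxE (negPf ji) andbF mulr0z.
have -> : lincomb a (x *m (Q%:Z)%:M) = g (f (lincomb a x)).
  rewrite ax gf // -ax !lincombE -sumrMnl; apply: eq_bigr => j _.
  by rewrite mul_mx_scalar mxE mulrC mulrzA -pmulrn.
rewrite -opprB -mulrN1z; apply: is_torsMz.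
rewrite -(subrKA (g (lincomb b (x *m F)))) -raddfB; apply: is_torsD.
  by apply: is_tors_map; apply: is_mx_of_lincomb.
by rewrite mulmxA; apply: is_mx_of_lincomb.
Qed.

Lemma mul_scal_min n m (F : 'M[int]_(n, m)) (G : 'M[int]_(m, n)) (z : int) :
  z != 0 -> F *m G = z%:M -> (n <= m)%N.
Proof.
move=> z0 FG.
have : map_mx intr F *m ((z%:~R)^-1 *: map_mx intr G) = 1%:M :> 'M[rat]_n.
  rewrite -scalemxAr -map_mxM FG map_scalar_mx scale_scalar_mx mulVf //.
  by rewrite intr_eq0.
by move=> h; rewrite -[n in (n <= _)%N](mxrank1 rat) -h mulmx_max_rank.
Qed.

Section Pairing.
Variables (M : zmodType) (L : fieldType) (pr : M -> M -> L).
Hypothesis L_char0 : [pchar L] =i pred0.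
Hypothesis prDl : forall x y z, pr (x + y) z = pr x z + pr y z.
Hypothesis prDr : forall x y z, pr x (y + z) = pr x y + pr x z.

Let prl y := to_additive (fun x x' => prDl x x' y).
Let prr x := to_additive (prDr x).

Lemma pairing_torsl t y : is_tors t -> pr t y = 0.
Proof.
move=> [n [n0 tn]]; apply/eqP; have := raddf0 (prl y); rewrite -tn raddfMn /=.
move/eqP; rewrite -mulr_natr mulf_eq0 => /orP[//|].
by rewrite (pcharf0P _).1 // -leqn0 leqNgt n0.
Qed.

Lemma pairing_torsr x t : is_tors t -> pr x t = 0.
Proof.
move=> [n [n0 tn]]; apply/eqP; have := raddf0 (prr x); rewrite -tn raddfMn /=.
move/eqP; rewrite -mulr_natr mulf_eq0 => /orP[//|].
by rewrite (pcharf0P _).1 // -leqn0 leqNgt n0.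
Qed.

Lemma pairing_eql x x' y : is_tors (x - x') -> pr x y = pr x' y.
Proof.
by move=> /pairing_torsl h; apply/eqP; rewrite -subr_eq0 -(raddfB (prl y)) /= h.
Qed.

Lemma pairing_eqr x y y' : is_tors (y - y') -> pr x y = pr x y'.
Proof.
by move=> /pairing_torsr h; apply/eqP; rewrite -subr_eq0 -(raddfB (prr x)) /= h.
Qed.

Lemma pairing_suml n (b : 'I_n -> M) (c : 'I_n -> int) y :
  pr (\sum_i b i *~ c i) y = \sum_i (c i)%:~R * pr (b i) y.
Proof.
rewrite -[pr _ _]/(prl y _) raddf_sum; apply: eq_bigr => i _.
by rewrite raddfMz mulrzl.
Qed.

Lemma pairing_sumr n (b : 'I_n -> M) (c : 'I_n -> int) x :
  pr x (\sum_i b i *~ c i) = \sum_i (c i)%:~R * pr x (b i).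
Proof.
rewrite -[pr _ _]/(prr x _) raddf_sum; apply: eq_bigr => i _.
by rewrite raddfMz mulrzl.
Qed.

(* [p] is the norm to the fixed group [A] of a subgroup of order [k] *)
Lemma gram_neq0 n1 (b1 : 'I_n1 -> M) (A : subgroup M) n (a : 'I_n -> M)
    (p : {additive M -> M}) (k : nat) :
    \det (gram pr b1) != 0 -> tf_basis (fun=> True) b1 -> tf_basis A a -> (0 < k)%N ->
    (forall x, A (p x)) -> (forall x, A x -> p x = x *+ k) ->
    (forall x y, A x -> pr x y *+ k = pr x (p y)) ->
  \det (gram pr a) != 0.
Proof.
move=> G1 hb1 ha k0 pA pk adj.
have [Aa _ _] := ha.
have [I hI] : exists I, is_mx_of (@idfun M) a b1 I.
  exact: (is_mx_of_exists (A := A) (B := sfull M)).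
have [P hP] : exists P, is_mx_of p b1 a P.
  exact: (is_mx_of_exists (A := fun=> True) (B := A)).
have IP : I *m P = (k%:Z)%:M by apply: (is_mx_of_scal ha hI hP) => x /pk.
have rel : k%:R *: (map_mx intr I *m gram pr b1) = gram pr a *m (map_mx intr P)^T.
  apply/matrixP => i j; rewrite !mxE.
  transitivity (pr (a i) (b1 j) *+ k).
    rewrite (pairing_eql _ (hI i)) pairing_suml mulr_natl; congr (_ *+ _).
    by apply: eq_bigr => m _; rewrite !mxE.
  rewrite adj // (pairing_eqr _ (hP j)) pairing_sumr.
  by apply: eq_bigr => m _; rewrite !mxE mulrC.
have kL : k%:R != 0 :> L by rewrite (pcharf0P _).1 // -lt0n.
(* If v kills the Gram matrix of A, then by [rel] v I kills the invertible one of M, so v I = 0, and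
   multiplying by P gives k v = 0. *)
apply/det0P => -[v v0 vG].
have : (v *m map_mx intr I) *m gram pr b1 = 0.
  apply: (scalerI kL); rewrite scaler0 -mulmxA scalemxAr rel mulmxA vG.
  by rewrite mul0mx.
move/(congr1 (mulmx^~ (invmx (gram pr b1)))); rewrite mulmxK ?mul0mx; last first.
  by rewrite unitmxE unitfE.
move/(congr1 (mulmx^~ (map_mx intr P))); rewrite mul0mx -mulmxA -map_mxM IP.
rewrite map_scalar_mx mul_mx_scalar => /eqP; rewrite scaler_eq0 => /orP[|/eqP e].
  by rewrite /= -[_%:~R]/(k%:R) (negPf kL).
by rewrite e eqxx in v0.
Qed.

End Pairing.

Section Adjoint.
Variables (l : nat) (L : fieldType).
Hypothesis L_char0 : [pchar L] =i pred0.
Variables (M N : zmodType) (prM : M -> M -> L) (prN : N -> N -> L).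
Hypothesis prMDr : forall x y z, prM x (y + z) = prM x y + prM x z.
Hypothesis prNDl : forall x y z, prN (x + y) z = prN x z + prN y z.
Hypotheses (fgM : zfg M) (fgN : zfg N).
Variables (A : subgroup M) (B : subgroup N) (n m : nat).
Variables (a : 'I_n -> M) (b : 'I_m -> N).
Hypotheses (ha : tf_basis A a) (hb : tf_basis B b).
Hypothesis finA : finite_index (stors A) (szero M).
Hypothesis finB : finite_index (stors B) (szero N).

(** Kernel and cokernel are killed by Q, hence finite. *)
Lemma quasi_inverse_isogeny (M' N' : zmodType) (A' : subgroup M') (B' : subgroup N')
    (f : {additive M' -> N'}) (g : {additive N' -> M'}) (Q : nat) :
    zfg M' -> zfg N' -> (0 < Q)%N ->
    (forall x, A' x -> B' (f x)) -> (forall x, B' x -> A' (g x)) ->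
    (forall x, A' x -> g (f x) = x *+ Q) -> (forall x, B' x -> f (g x) = x *+ Q) ->
  isogeny f A' (szero M') B' (szero N').
Proof.
move=> fgM' fgN' Q0 fA gB gf fg; split=> //.
- by move=> x ->; apply: smem0.
- by move=> x ->; apply: smem0.
- by move=> x -> /=; rewrite raddf0.
- apply: (zfg_finite_index fgN' Q0) => x Bx; apply: sjoinl.
  by exists (g x); [apply: gB|rewrite fg].
- apply: (zfg_finite_index fgM' Q0) => x [Ax /= fx].
  by rewrite -gf // fx raddf0.
Qed.

Variables (Q : nat) (f f' : {additive M -> N}) (g g' : {additive N -> M}).
Hypothesis Q0 : (0 < Q)%N.
Hypotheses (fA : forall x, A x -> B (f x)) (gB : forall y, B y -> A (g y)).
Hypotheses (f'A : forall x, A x -> B (f' x)) (g'B : forall y, B y -> A (g' y)).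
Hypotheses (gf : forall x, A x -> g (f x) = x *+ Q) (fg : forall y, B y -> f (g y) = y *+ Q).
Hypotheses (gf' : forall x, A x -> g' (f' x) = x *+ Q) (fg' : forall y, B y -> f' (g' y) = y *+ Q).
Hypothesis adj : forall x y, A x -> B y -> prN (f x) y = prM x (g' y).

(** On bases, adjointness reads F Gram(b) = Gram(a) G'^T, so u = det F and v = det G'. The
    quasi-inverses [g] of [f] and [f'] of [g'] make both determinants nonzero. *)
Lemma adjoint_gram : exists u v : int,
  [/\ u != 0, v != 0, u%:~R * \det (gram prN b) = v%:~R * \det (gram prM a),
   herb l f A (szero M) B (szero N) =
    (logn l `|u|)%:Z + (vidx l (stors B) (szero N))%:Z - (vidx l (stors A) (szero M))%:Z &
   herb l g' B (szero N) A (szero M) =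
    (logn l `|v|)%:Z + (vidx l (stors A) (szero M))%:Z - (vidx l (stors B) (szero N))%:Z].
Proof.
have [Aa _ _] := ha; have [Bb _ _] := hb.
have [F hF] := is_mx_of_exists Aa hb fA.
have [G hG] := is_mx_of_exists Bb ha gB.
have [F' hF'] := is_mx_of_exists Aa hb f'A.
have [G' hG'] := is_mx_of_exists Bb ha g'B.
have Qz : Q%:Z != 0 by rewrite eqz_nat -lt0n.
have FG := is_mx_of_scal ha hF hG gf.
have GF := is_mx_of_scal hb hG hF fg.
have FG' := is_mx_of_scal ha hF' hG' gf'.
have rel : map_mx intr F *m gram prN b = gram prM a *m (map_mx intr G')^T.
  apply/matrixP => i j; rewrite !mxE.
  transitivity (prN (f (a i)) (b j)).
    rewrite (pairing_eql L_char0 prNDl _ (hF i)) (pairing_suml prNDl).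
    by apply: eq_bigr => k _; rewrite !mxE.
  rewrite adj // (pairing_eqr L_char0 prMDr _ (hG' j)) (pairing_sumr prMDr).
  by apply: eq_bigr => k _; rewrite !mxE mulrC.
(* Quasi-inverses on both sides force equal ranks; only then are the matrices square. *)
have nm : n = m.
  by apply/eqP; rewrite eqn_leq (mul_scal_min Qz FG) (mul_scal_min Qz GF).
subst m.
have nz (X Y : 'M[int]_n) : X *m Y = (Q%:Z)%:M -> \det X != 0 /\ \det Y != 0.
  move=> /(congr1 determinant); rewrite det_mulmx det_scalar => e.
  by apply/andP; rewrite -negb_or -mulf_eq0 e expf_neq0.
have [F0 _] := nz _ _ FG; have [_ G0] := nz _ _ FG'.
exists (\det F), (\det G'); split=> //.
- have := congr1 determinant rel; rewrite !det_mulmx det_tr -!det_map_mx => ->.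
  by rewrite mulrC.
- apply: (herb_det l ha hb) => //.
  exact: (quasi_inverse_isogeny fgM fgN Q0 fA gB).
- apply: (herb_det l hb ha) => //.
  exact: (quasi_inverse_isogeny fgN fgM Q0 g'B f'A).
Qed.

End Adjoint.

(** * A decision procedure for identities in abelian groups *)

Inductive zexpr :=
  | ZVar of nat | ZZero | ZAdd of zexpr & zexpr | ZOpp of zexpr.

Fixpoint zeval (M : zmodType) (env : seq M) e : M :=
  match e with
  | ZVar i => env`_i
  | ZZero => 0
  | ZAdd e1 e2 => zeval env e1 + zeval env e2
  | ZOpp e1 => - zeval env e1
  end.

Fixpoint zcoef e (i : nat) : int :=
  match e with
  | ZVar j => (i == j)%:R
  | ZZero => 0
  | ZAdd e1 e2 => zcoef e1 i + zcoef e2 i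
  | ZOpp e1 => - zcoef e1 i
  end.

(** A variable beyond the environment evaluates to the default 0 of [nth], so the sum may stop at
    [size env]. *)
Lemma zevalE (M : zmodType) (env : seq M) e :
  zeval env e = \sum_(i < size env) env`_i *~ zcoef e i.
Proof.
elim: e => [j||e1 IH1 e2 IH2|e1 IH1] /=.
- have [lt|ge] := ltnP j (size env); last first.
    rewrite nth_default // big1 // => i _.
    by rewrite ltn_eqF ?mulr0z //; apply: leq_trans ge.
  rewrite (bigD1 (Ordinal lt)) //= eqxx mulr1z big1 ?addr0 // => i.
  by rewrite -val_eqE /= => /negPf ->; rewrite mulr0z.
- by rewrite big1 // => i _; rewrite mulr0z.
- by rewrite IH1 IH2 -big_split; apply: eq_bigr => i _; rewrite mulrzDr.
- by rewrite IH1 -sumrN; apply: eq_bigr => i _; rewrite mulrNz.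
Qed.

Lemma zeval_eq (M : zmodType) (env : seq M) e1 e2 :
  all (fun i => zcoef e1 i == zcoef e2 i) (iota 0 (size env)) ->
  zeval env e1 = zeval env e2.
Proof.
move/allP => h; rewrite !zevalE; apply: eq_bigr => i _.
by rewrite (eqP (h i _)) // mem_iota /= add0n.
Qed.

Ltac zmem_index x env :=
  lazymatch env with
  | x :: _ => constr:(0%N)
  | _ :: ?env' => let i := zmem_index x env' in constr:(i.+1)
  end.

Ltac zadd_var x env :=
  match env with
  | _ => let i := zmem_index x env in env
  | _ => constr:(x :: env)
  end.

Ltac zvars t env :=
  lazymatch t with
  | @Algebra.add _ ?a ?b => let env := zvars a env in zvars b env
  | @Algebra.opp _ ?a => zvars a env
  | @Algebra.zero _ => env
  | _ => zadd_var t env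
  end.

Ltac zreify t env :=
  lazymatch t with
  | @Algebra.add _ ?a ?b =>
      let a' := zreify a env in let b' := zreify b env in constr:(ZAdd a' b')
  | @Algebra.opp _ ?a => let a' := zreify a env in constr:(ZOpp a')
  | @Algebra.zero _ => constr:(ZZero)
  | _ => let i := zmem_index t env in constr:(ZVar i)
  end.

(** Multiples such as [x *+ q] and values such as [w x] are atoms: operators have to be pushed
    inwards before the call. *)
Ltac abel :=
  lazymatch goal with
  | |- @eq ?T ?a ?b =>
      let env := zvars a (@nil T) in
      let env := zvars b env in
      let a' := zreify a env in
      let b' := zreify b env in
      refine (@zeval_eq _ env a' b' _); vm_compute; reflexivity
  end.

Lemma mulrn_pair (M N : zmodType) (x : M) (y : N) n : (x, y) *+ n = (x *+ n, y *+ n).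
Proof. by elim: n => // n IHn; rewrite !mulrS IHn. Qed.

Definition muln_add (M : zmodType) (q : nat) : {additive M -> M} :=
  to_additive (fun x y => mulrnDl q x y : (x + y) *+ q = x *+ q + y *+ q).

(** * Congruent maps, commuting squares, multiplication by q *)

Section HerbTools.
Variable l : nat.

Lemma herb_congr (M N : zmodType) (f g : {additive M -> N}) (A A0 : subgroup M)
    (B B0 : subgroup N) :
    (forall x, A x -> B0 (f x - g x)) -> isogeny f A A0 B B0 ->
  isogeny g A A0 B B0 /\ herb l g A A0 B B0 = herb l f A A0 B B0.
Proof.
move=> fg [A0A B0B fA fA0 fcok fker].
have gf x : A x -> B0 (g x - f x) by move=> /fg h; rewrite -opprB; apply: smemN.
have cong (h k : {additive M -> N}) : (forall x, A x -> B0 (h x - k x)) ->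
    sle (sjoin (simg h A) B0) (sjoin (simg k A) B0) /\
    sle (smeet A (spre h B0)) (smeet A (spre k B0)).
  move=> hk; split=> [_ [_ [b [[a Aa ->] Bb ->]]]|x [Ax hx]].
    exists (k a), (h a - k a + b); rewrite addrA subrKC; split=> //; first by exists a.
    by apply: smemD => //; apply: hk.
  by split=> //; apply: smem_subr (hk x Ax) hx.
have [j1 k1] := cong _ _ fg; have [j2 k2] := cong _ _ gf.
have gcok : finite_index B (sjoin (simg g A) B0) by apply: finite_index_sub fcok.
have gker : finite_index (smeet A (spre g B0)) A0 by apply: finite_index_sub fker.
split.
  split=> // x Ax; first by rewrite -[g x](subrK (f x)); apply: smemD; [apply/B0B/gf|apply: fA].
  by apply: smem_subl (f x) _ _; [apply/gf/A0A|apply: fA0].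
rewrite /herb /coker_vidx /ker_vidx.
have ec := vidx_eq l (@sle_refl _ B) (@sle_refl _ B) j2 j1 gcok.
have ek := vidx_eq l k2 k1 (@sle_refl _ A0) (@sle_refl _ A0) gker.
by rewrite ec ek.
Qed.

(** The vertical isomorphisms contribute 0 to both composites. With projections for [p] and [p'],
    this identifies the map induced on a subquotient. *)
Lemma herb_square (M N M' N' : zmodType) (f : {additive M -> N})
    (f' : {additive M' -> N'}) (p : {additive M -> M'}) (p' : {additive N -> N'})
    (A A0 : subgroup M) (B B0 : subgroup N)
    (A' A0' : subgroup M') (B' B0' : subgroup N') :
    isogeny f A A0 B B0 -> isogeny f' A' A0' B' B0' ->
    isogeny p A A0 A' A0' /\ herb l p A A0 A' A0' = 0 ->
    isogeny p' B B0 B' B0' /\ herb l p' B B0 B' B0' = 0 ->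
    (forall x, A x -> B0' (f' (p x) - p' (f x))) ->
  herb l f A A0 B B0 = herb l f' A' A0' B' B0'.
Proof.
move=> hf hf' [hp p0] [hp' p0'] comm.
have [i1 e1] := herb_comp l hp hf'.
have [i2 e2] := herb_comp l hf hp'.
have [_] := herb_congr (f := f' \o p) (g := p' \o f) comm i1.
by rewrite e1 e2 p0 p0' addr0 add0r.
Qed.

Lemma is_tors_eq0 (M : zmodType) (x : M) : x = 0 -> is_tors x.
Proof. by move=> ->; apply: is_tors0. Qed.

Lemma herb_scale (M : zmodType) (A : subgroup M) n (a : 'I_n -> M) q :
    zfg M -> tf_basis A a -> finite_index (stors A) (szero M) -> (0 < q)%N ->
  isogeny (muln_add M q) A (szero M) A (szero M) /\
  herb l (muln_add M q) A (szero M) A (szero M) = n%:Z * (logn l q)%:Z.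
Proof.
move=> fgM ha finA q0.
have hi : isogeny (muln_add M q) A (szero M) A (szero M).
  split.
  - by move=> x ->; apply: smem0.
  - by move=> x ->; apply: smem0.
  - by move=> x Ax; apply: smemMn.
  - by move=> x -> /=; rewrite mul0rn.
  - by apply: (zfg_finite_index fgM q0) => x Ax; apply: sjoinl; exists x.
  - by apply: (zfg_finite_index fgM q0) => x [].
split=> //.
rewrite (herb_det l (F := (q%:Z)%:M) ha ha) //.
- by rewrite det_scalar abszX lognX /= PoszM; ring.
- by move=> x Ax; apply: smemMn.
- move=> i; apply: is_tors_eq0; rewrite (bigD1 i) //= big1 => [|j ji].
    by rewrite mxE eqxx addr0 mulr1n -pmulrn subrr.
  by rewrite mxE eq_sym (negPf ji) mulr0z.
- by rewrite det_scalar expf_neq0 // eqz_nat -lt0n.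
Qed.

End HerbTools.

(** * Bases, generators and torsion of direct sums *)

Lemma split_lshift n m (i : 'I_n) : split (lshift m i) = inl i.
Proof. exact: (unsplitK (inl i)). Qed.

Lemma split_rshift n m (i : 'I_m) : split (rshift n i) = inr i.
Proof. exact: (unsplitK (inr i)). Qed.

Definition basis_prod (M N : zmodType) n m (a : 'I_n -> M) (b : 'I_m -> N)
    (i : 'I_(n + m)) : M * N :=
  match split i with inl j => (a j, 0) | inr k => (0, b k) end.

Lemma basis_prodl (M N : zmodType) n m (a : 'I_n -> M) (b : 'I_m -> N) i :
  basis_prod a b (lshift m i) = (a i, 0).
Proof. by rewrite /basis_prod split_lshift. Qed.

Lemma basis_prodr (M N : zmodType) n m (a : 'I_n -> M) (b : 'I_m -> N) i :
  basis_prod a b (rshift n i) = (0, b i).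
Proof. by rewrite /basis_prod split_rshift. Qed.

Lemma basis_prod_sum (M N : zmodType) n m (a : 'I_n -> M) (b : 'I_m -> N)
    (c : 'I_(n + m) -> int) :
  \sum_i basis_prod a b i *~ c i =
    (\sum_i a i *~ c (lshift m i), \sum_i b i *~ c (rshift n i)).
Proof.
rewrite big_split_ord /=; under eq_bigr do rewrite basis_prodl.
under [X in _ + X]eq_bigr do rewrite basis_prodr.
rewrite [LHS]surjective_pairing /=.
rewrite !raddf_sum /=; congr pair.
  rewrite [X in _ + X]big1 ?addr0 => [|i _]; last by rewrite raddfMz mul0rz.
  by apply: eq_bigr => i _; rewrite raddfMz.
rewrite big1 ?add0r => [|i _]; last by rewrite raddfMz mul0rz.
by apply: eq_bigr => i _; rewrite raddfMz.
Qed.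

Lemma is_tors_pair (M N : zmodType) (x : M) (y : N) :
  is_tors (x, y) <-> is_tors x /\ is_tors y.
Proof.
split=> [t|[[n [n0 xn]] [m [m0 ym]]]].
  by split; [apply: (is_tors_map (@fst M N) t)|apply: (is_tors_map (@snd M N) t)].
exists (n * m)%N; rewrite muln_gt0 n0 m0 mulrn_pair; split=> //.
by rewrite mulrnA xn mul0rn mulnC mulrnA ym mul0rn.
Qed.

Lemma tf_basis_prod (M N : zmodType) (A : subgroup M) (B : subgroup N) n m
    (a : 'I_n -> M) (b : 'I_m -> N) :
  tf_basis A a -> tf_basis B b -> tf_basis (sprod A B) (basis_prod a b).
Proof.
move=> [Aa aspan afree] [Bb bspan bfree]; split.
- move=> i; case: (split_ordP i) => j ->; rewrite ?basis_prodl ?basis_prodr.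
    by split; [apply: Aa|apply: smem0].
  by split; [apply: smem0|apply: Bb].
- move=> [x y] [/= /aspan[c hc] /bspan[d hd]].
  exists (fun i => match split i with inl j => c j | inr k => d k end).
  rewrite basis_prod_sum; apply/is_tors_pair; split.
    by congr (is_tors (_ - _)): hc; apply: eq_bigr => i _; rewrite split_lshift.
  by congr (is_tors (_ - _)): hd; apply: eq_bigr => i _; rewrite split_rshift.
- move=> c; rewrite basis_prod_sum => /is_tors_pair[/afree hc /bfree hd] i.
  by case: (split_ordP i) => j ->.
Qed.

Lemma zfg_prod (M N : zmodType) : zfg M -> zfg N -> zfg (M * N)%type.
Proof.
move=> [n [a ha]] [m [b hb]]; exists (n + m)%N, (basis_prod a b) => -[x y].
have [c ->] := ha x; have [d ->] := hb y.
exists (fun i => match split i with inl j => c j | inr k => d k end).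
rewrite basis_prod_sum; congr pair; apply: eq_bigr => i _.
  by rewrite split_lshift.
by rewrite split_rshift.
Qed.

Lemma tors_prod (M N : zmodType) (A : subgroup M) (B : subgroup N) :
    finite_index (stors A) (szero M) -> finite_index (stors B) (szero N) ->
  finite_index (stors (sprod A B)) (szero (M * N)%type) /\
  forall l, vidx l (stors (sprod A B)) (szero (M * N)%type) =
    (vidx l (stors A) (szero M) + vidx l (stors B) (szero N))%N.
Proof.
move=> [n hn] [m hm].
have h : has_qcard (stors (sprod A B)) (szero (M * N)%type) (n * m).
  apply: eq_has_qcard (has_qcard_prod hn hm).
  - by move=> [x y] [[tx Ax] [ty By]]; split=> //; apply/is_tors_pair.
  - by move=> [x y] [/is_tors_pair[tx ty] [Ax By]].
  - by move=> [x y] [/= -> ->].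
  - by move=> [x y] [/= -> ->].
split=> [|l]; first by exists (n * m)%N.
rewrite (vidxE l h) (vidxE l hn) (vidxE l hm) lognM //.
  exact: (has_qcard_gt0 hn).
exact: (has_qcard_gt0 hm).
Qed.

(** * The dihedral isogenies *)

(* [w] is the square root [r ^ ((q + 1) / 2)] of [r], [wi] its inverse, [N] the
   norm of <r>, and [P] inverts [w - wi] up to [q] on the kernel of [N] *)
Record dihedral_ops (q : nat) (M : zmodType) (r s w wi N P : {additive M -> M}) : Prop :=
  DihedralOps {
  ops_wK : forall x, wi (w x) = x;
  ops_wiK : forall x, w (wi x) = x;
  ops_ww : forall x, w (w x) = r x;
  ops_wfix : forall x, r x = x -> w x = x;
  ops_sK : forall x, s (s x) = x;
  ops_sw : forall x, s (w x) = wi (s x);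
  ops_Nw : forall x, N (w x) = N x;
  ops_wN : forall x, w (N x) = N x;
  ops_sN : forall x, s (N x) = N (s x);
  ops_Nfix : forall x, w x = x -> N x = x *+ q;
  ops_sP : forall x, s (P x) = - P (s x);
  ops_wP : forall x, w (P x) = P (w x);
  ops_NP : forall x, N (P x) = 0;
  ops_Pfix : forall x, w x = x -> P x = 0;
  ops_dP : forall x, w (P x) - wi (P x) = x *+ q - N x }.

Section Dihedral.
Variables (l q : nat) (M : zmodType) (r s w wi N P : {additive M -> M}).
Hypothesis ops : dihedral_ops q r s w wi N P.
Hypothesis q0 : (0 < q)%N.
Hypothesis fgM : zfg M.

Let wK := ops_wK ops.
Let wiK := ops_wiK ops.
Let sK := ops_sK ops.
Let sw := ops_sw ops.
Let Nw := ops_Nw ops.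
Let wN := ops_wN ops.
Let sN := ops_sN ops.
Let sP := ops_sP ops.
Let wP := ops_wP ops.
Let NP := ops_NP ops.

Lemma swi x : s (wi x) = w (s x).
Proof. by rewrite -{1}[x]sK -sw sK. Qed.

Lemma Nwi x : N (wi x) = N x.
Proof. by rewrite -[in RHS](wiK x) Nw. Qed.

Lemma wiN x : wi (N x) = N x.
Proof. by rewrite -[in LHS]wN wK. Qed.

Lemma wiP x : wi (P x) = P (wi x).
Proof. by rewrite -{1}[x]wiK -wP wK. Qed.

Lemma wifix x : w x = x -> wi x = x.
Proof. by move=> e; rewrite -{1}e wK. Qed.

Lemma PN x : P (N x) = 0.
Proof. exact: (ops_Pfix ops). Qed.

Lemma NN x : N (N x) = N x *+ q.
Proof. exact: (ops_Nfix ops). Qed.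

(** The identity (w - w^-1) P = q - N, oriented so as to eliminate P w; it is the last rewriting
    before [abel]. *)
Lemma Pw x : P (w x) = P (wi x) + x *+ q - N x.
Proof. by rewrite -wP -wiP -addrA -(ops_dP ops) subrKC. Qed.

Lemma rfix x : r x = x <-> w x = x.
Proof.
split=> [/(ops_wfix ops)//|e]; by rewrite -(ops_ww ops) !e.
Qed.

Program Definition sinvR := @Subgroup M (invR r) _ _.
Next Obligation. exact: raddf0. Qed.
Next Obligation. by move=> x y; rewrite /invR => ex ey; rewrite raddfB ex ey. Qed.

Program Definition sinvS := @Subgroup M (invS s) _ _.
Next Obligation. exact: raddf0. Qed.
Next Obligation. by move=> x y; rewrite /invS raddfB => -> ->. Qed.

Program Definition sinvD := @Subgroup M (invD r s) _ _.
Next Obligation. by split; exact: raddf0. Qed.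
Next Obligation.
by move=> x y [rx sx] [ry sy]; rewrite /invD !raddfB rx sx ry sy.
Qed.

#[local] Arguments smem : simpl never.

Notation MR := sinvR.
Notation MS := sinvS.
Notation MD := sinvD.

Lemma MRw x : MR x -> w x = x. Proof. by move/rfix. Qed.
Lemma MRwi x : MR x -> wi x = x. Proof. by move/MRw/wifix. Qed.
Lemma MRN x : MR x -> N x = x *+ q. Proof. by move/MRw/(ops_Nfix ops). Qed.
Lemma MRP x : MR x -> P x = 0. Proof. by move/MRw/(ops_Pfix ops). Qed.
Lemma MR_of_w x : w x = x -> MR x. Proof. by move=> /rfix. Qed.

Lemma MSE x : MS x = (s x = x). Proof. by []. Qed.

Lemma MSx x : MS x -> s x = x. Proof. by []. Qed.

Lemma MR_s x : MR x -> MR (s x).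
Proof. by move=> /MRwi e; apply: MR_of_w; rewrite -swi e. Qed.

Lemma MR_N x : MR (N x).
Proof. exact: MR_of_w. Qed.

Lemma MD_of x : MR x -> MS x -> MD x. Proof. by []. Qed.
Lemma MD_R x : MD x -> MR x. Proof. by case. Qed.
Lemma MD_S x : MD x -> MS x. Proof. by case. Qed.

Lemma MD_N x : MS x -> MD (N x).
Proof. by move=> e; apply: MD_of; [apply: MR_N|rewrite MSE sN e]. Qed.

Lemma MS_tr x : MS (x + s x).
Proof. by rewrite MSE raddfD sK addrC. Qed.

Lemma MD_tr x : MR x -> MD (x + s x).
Proof. by move=> e; apply: MD_of; [apply: smemD => //; apply: MR_s|apply: MS_tr]. Qed.

Lemma MS_P x : s x = - x -> MS (P x).
Proof. by move=> e; rewrite MSE sP e raddfN opprK. Qed.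

Let linE := (raddfD w, raddfD wi, raddfD s, raddfD N, raddfD P,
  raddfN w, raddfN wi, raddfN s, raddfN N, raddfN P,
  raddfMn w, raddfMn wi, raddfMn s, raddfMn N, raddfMn P).

Notation M3 := (M * (M * M))%type.

Lemma dih_f_add (p p' : M3) :
  let f (p : M3) := (p.1 + w p.2.1 + p.2.2, (N p.1, N p.2.1)) : M3 in
  f (p + p') = f p + f p'.
Proof.
move: p p' => [x [y z]] [x' [y' z']] f; congr (_, (_, _)); rewrite /= !linE; abel.
Qed.
Definition dih_f := to_additive dih_f_add.

(** This solves f (x, y, z) = (m, u, v) up to q. One has m - s m = (w - w^-1) y + (z - s z); P kills
    the last term, so P (m - s m) = q y - v. In the same way w^-1 m gives x, and N m = u + v + q z
    gives z. *)
Lemma dih_g_add (p p' : M3) :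
  let g (p : M3) := (p.2.1 - P (wi p.1 - s (wi p.1)),
     (p.2.2 + P (p.1 - s p.1), N p.1 - p.2.1 - p.2.2)) : M3 in
  g (p + p') = g p + g p'.
Proof.
move: p p' => [x [y z]] [x' [y' z']] g; congr (_, (_, _)); rewrite /= !linE; abel.
Qed.
Definition dih_g := to_additive dih_g_add.

Lemma dih_ft_add (p p' : M3) :
  let h (p : M3) := (p.1 + s p.1 + p.2.1,
    (wi p.1 + s (wi p.1) + p.2.2, N p.1)) : M3 in
  h (p + p') = h p + h p'.
Proof.
move: p p' => [x [y z]] [x' [y' z']] h; congr (_, (_, _)); rewrite /= !linE; abel.
Qed.
Definition dih_ft := to_additive dih_ft_add.

(** This solves f' (m, u, v) = (x, y, z) up to q. One has w x - y = (w - w^-1) m + u - v; P kills u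
    - v, so w P x - P y = q m - z. Applying N to x and to y then gives q u and q v. *)
Lemma dih_gt_add (p p' : M3) :
  let h (p : M3) := (w (P p.1) - P p.2.1 + p.2.2,
    (N p.1 - (p.2.2 + s p.2.2), N p.2.1 - (p.2.2 + s p.2.2))) : M3 in
  h (p + p') = h p + h p'.
Proof.
move: p p' => [x [y z]] [x' [y' z']] h; congr (_, (_, _)); rewrite /= !linE; abel.
Qed.
Definition dih_gt := to_additive dih_gt_add.

Definition srcA := sprod MS (sprod MS MR).
Definition tgtB := sprod (sfull M) (sprod MD MD).

Lemma dih_f_maps p : srcA p -> tgtB (dih_f p).
Proof. by move: p => [x [y z]] [/= Sx [/= Sy Rz]]; split=> //; split; apply: MD_N. Qed.

Lemma anti_fix x : s (x - s x) = - (x - s x).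
Proof. by rewrite raddfB sK opprB. Qed.

Lemma dih_g_maps p : tgtB p -> srcA (dih_g p).
Proof.
move: p => [m [u v]] [_ [/= Du Dv]].
split; last split; rewrite /=.
- by apply: smemB; [apply: MD_S|apply/MS_P/anti_fix].
- by apply: smemD; [apply: MD_S|apply/MS_P/anti_fix].
- by apply: smemB; [apply: smemB; [apply: MR_N|apply: MD_R]|apply: MD_R].
Qed.

Lemma dih_ft_maps p : tgtB p -> srcA (dih_ft p).
Proof.
move: p => [m [u v]] [_ [/= Du Dv]].
split; last split; rewrite /=; last exact: MR_N.
- by apply: smemD; [apply: MS_tr|apply: MD_S].
- by apply: smemD; [apply: MS_tr|apply: MD_S].
Qed.

Lemma dih_gt_maps p : srcA p -> tgtB (dih_gt p).
Proof.
move: p => [x [y z]] [/= Sx [/= Sy Rz]]; split=> //.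
by split; apply: smemB; (apply: MD_N || apply: MD_tr).
Qed.

Let opsE := (linE, wK, wiK, sK, sw, swi, Nw, Nwi, wN, wiN, sN, sP, NP, PN, NN, wP, wiP).

Let MRE x (Rx : MR x) := (MRw Rx, MRwi Rx, MRN Rx, MRP Rx).

Lemma dih_gf p : srcA p -> dih_g (dih_f p) = p *+ q.
Proof.
move: p => [x [y z]] [/= Sx [/= Sy Rz]].
rewrite /= !mulrn_pair; congr (_, (_, _)).
- by rewrite /= !(opsE, MSx Sx, MSx Sy, MRE Rz, MRE (MR_s Rz)) !Pw; abel.
- by rewrite /= !(opsE, MSx Sx, MSx Sy, MRE Rz, MRE (MR_s Rz)) !Pw; abel.
- by rewrite /= !(opsE, MSx Sx, MSx Sy, MRE Rz); abel.
Qed.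

Lemma dih_fg p : tgtB p -> dih_f (dih_g p) = p *+ q.
Proof.
move: p => [m [u v]] [_ [/= Du Dv]].
have [Ru Rv] := (MD_R Du, MD_R Dv); have [Su Sv] := (MD_S Du, MD_S Dv).
rewrite /= !mulrn_pair; congr (_, (_, _)).
- by rewrite /= !(opsE, MRE Ru, MRE Rv, MSx Su, MSx Sv) !Pw; abel.
- by rewrite /= !(opsE, MRE Ru, MRE Rv, MSx Su, MSx Sv); abel.
- by rewrite /= !(opsE, MRE Ru, MRE Rv, MSx Su, MSx Sv); abel.
Qed.

Lemma dih_gft p : tgtB p -> dih_gt (dih_ft p) = p *+ q.
Proof.
move: p => [m [u v]] [_ [/= Du Dv]].
have [Ru Rv] := (MD_R Du, MD_R Dv); have [Su Sv] := (MD_S Du, MD_S Dv).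
rewrite /= !mulrn_pair; congr (_, (_, _)).
- by rewrite /= !(opsE, MRE Ru, MRE Rv, MSx Su, MSx Sv) !Pw; abel.
- by rewrite /= !(opsE, MRE Ru, MRE Rv, MSx Su, MSx Sv); abel.
- by rewrite /= !(opsE, MRE Ru, MRE Rv, MSx Su, MSx Sv); abel.
Qed.

Lemma dih_ftg p : srcA p -> dih_ft (dih_gt p) = p *+ q.
Proof.
move: p => [x [y z]] [/= Sx [/= Sy Rz]].
rewrite /= !mulrn_pair; congr (_, (_, _)).
- by rewrite /= !(opsE, MSx Sx, MSx Sy, MRE Rz, MRE (MR_s Rz)) !Pw; abel.
- by rewrite /= !(opsE, MSx Sx, MSx Sy, MRE Rz, MRE (MR_s Rz)) !Pw; abel.
- by rewrite /= !(opsE, MSx Sx, MSx Sy, MRE Rz, MRE (MR_s Rz)); abel.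
Qed.

(** * The reduced maps modulo fixed points *)

Notation M2 := (M * M)%type.

Lemma gq_add (p p' : M2) :
  let h (p : M2) := p.1 + w p.2 in h (p + p') = h p + h p'.
Proof. by move: p p' => [x y] [x' y'] h; rewrite /h /= !linE; abel. Qed.
Definition gq := to_additive gq_add.

Lemma gqt_add (m m' : M) :
  let h (m : M) := (m + s m, wi m + s (wi m)) : M2 in h (m + m') = h m + h m'.
Proof. by move=> h; congr (_, _); rewrite /= !linE; abel. Qed.
Definition gqt := to_additive gqt_add.

Lemma swapn_add (p p' : M2) :
  let h (p : M2) := (p.2, - p.1) : M2 in h (p + p') = h p + h p'.
Proof. by move: p p' => [x y] [x' y'] h; congr (_, _); rewrite /=; abel. Qed.
Definition swapn := to_additive swapn_add.

(** Up to the automorphism w^-1 this is 1 - r, the generator of the augmentation ideal of R. *)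
Lemma delta_add (m m' : M) :
  let h (m : M) := wi m - w m in h (m + m') = h m + h m'.
Proof. by move=> h; rewrite /h !linE; abel. Qed.
Definition delta := to_additive delta_add.

Lemma deltaE m : delta m = wi m - w m. Proof. by []. Qed.

Lemma gq_swapn_gqt m : gq (swapn (gqt m)) = delta m.
Proof. by rewrite /= !opsE; abel. Qed.

Definition X1 := sprod MS MS.
Definition X0 := sprod MD MD.
Definition MT := sfull M.

Hypothesis finT : forall A : subgroup M, finite_index (stors A) (szero M).

Let fgM2 : zfg M2 := zfg_prod fgM fgM.
Let fgM3 : zfg M3 := zfg_prod fgM fgM2.

Lemma szero_sle (K : zmodType) (A : subgroup K) : sle (szero K) A.
Proof. by move=> x ->; apply: smem0. Qed.

Lemma szero_map (K K' : zmodType) (f : {additive K -> K'}) x :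
  szero K x -> szero K' (f x).
Proof. by move=> ->; rewrite raddf0; apply: smem0. Qed.

Lemma X01 : sle X0 X1.
Proof. by move=> [x y] [/= Dx Dy]; split; apply: MD_S. Qed.

(** Finiteness is inherited from [dih_f] and [dih_g], evaluated at (x, y, 0) and (m, 0, 0): kernel
    and cokernel are killed by q. *)
Lemma gq_isogeny : isogeny gq X1 X0 MT MR.
Proof.
split=> //; first exact: X01.
- by move=> [x y] [/= /MD_R Rx /MD_R Ry]; rewrite (MRw Ry); apply: smemD.
- apply: (zfg_finite_index fgM q0) => m _.
  have tm : tgtB (m, (0, 0)) by split=> //; split; apply: smem0.
  have [Sx [Sy Rz]] := dih_g_maps tm.
  have := congr1 fst (dih_fg tm); rewrite mulrn_pair [X in _ = X]/= => <-.
  apply: smemD; last exact: sjoinr.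
  by apply: sjoinl; exists ((dih_g (m, (0, 0))).1, (dih_g (m, (0, 0))).2.1).
- apply: (zfg_finite_index fgM2 q0) => -[x y] [[/= Sx Sy] Rm].
  have sA : srcA (x, (y, 0)) by split=> //; split=> //; apply: smem0.
  have := dih_gf sA; rewrite /= addr0 !mulrn_pair => -[<- <- _].
  have {}Rm : MR (x + w y) := Rm.
  (* Once x + w y is fixed by R, both terms in P vanish, leaving q x = N x and q y = N y, which lie
     in M^D. *)
  have Pm := MRP (smemB Rm (MR_s Rm)).
  rewrite (MRwi Rm) /= in Pm *; rewrite Pm subr0 addr0.
  by split; apply: MD_N.
Qed.

Lemma gqt_isogeny : isogeny gqt MT MR X1 X0.
Proof.
split=> //; first exact: X01.
- by move=> m _; split; apply: MS_tr.
- by move=> m Rm; split; rewrite /= ?(MRwi Rm); apply: MD_tr.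
- apply: (zfg_finite_index fgM2 q0) => -[x y] [/= Sx Sy].
  have sA : srcA (x, (y, 0)) by split=> //; split=> //; apply: smem0.
  have := dih_ftg sA; rewrite !mulrn_pair => -[<- <- _].
  have [_ [Du Dv]] := dih_gt_maps sA.
  set p := dih_gt _ in Du Dv *.
  exists (gqt p.1), (p.2.1, p.2.2); split=> //; first by exists p.1.
- apply: (zfg_finite_index fgM q0) => m [_ [/= Du Dv]].
  have tm : tgtB (m, (0, 0)) by split=> //; split; apply: smem0.
  have := dih_gft tm; rewrite /= !mulrn_pair !addr0 => -[<- _ _].
  rewrite (MRP (MD_R Du)) (MRP (MD_R Dv)) raddf0 subrr add0r.
  exact: MR_N.
Qed.

(** The fixed points to be split off: the quotients srcA / srcA0 and tgtB / tgtB0 are (M^S / M^D)^2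
    and M / M^R, where [dih_f] and [dih_ft] induce [gq] and [gqt]. *)
Definition srcA0 := sprod MD (sprod MD MR).
Definition tgtB0 := sprod MR (sprod MD MD).

Lemma srcA0_sle : sle srcA0 srcA.
Proof. by move=> [x [y z]] [/= Dx [/= Dy Rz]]; split; [|split=> //]; apply: MD_S. Qed.

Lemma tgtB0_sle : sle tgtB0 tgtB.
Proof. by move=> [x [y z]] []. Qed.

Lemma dih_f_map0 p : srcA0 p -> tgtB0 (dih_f p).
Proof.
move: p => [x [y z]] [/= Dx [/= Dy Rz]]; have [Rx Ry] := (MD_R Dx, MD_R Dy).
split; last by split; apply/MD_N/MD_S.
by rewrite /= (MRw Ry); apply: smemD => //; apply: smemD.
Qed.

Lemma dih_g_map0 p : tgtB0 p -> srcA0 (dih_g p).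
Proof.
move: p => [m [u v]] [/= Rm [/= Du Dv]].
have Pm : P (m - s m) = 0 by apply: MRP; apply: smemB => //; apply: MR_s.
split; last split; rewrite /= ?(MRwi Rm) ?Pm ?subr0 ?addr0 //.
by apply: smemB; [apply: smemB; [apply: MR_N|apply: MD_R]|apply: MD_R].
Qed.

Lemma dih_ft_map0 p : tgtB0 p -> srcA0 (dih_ft p).
Proof.
move: p => [m [u v]] [/= Rm [/= Du Dv]].
split; last split; rewrite /= ?(MRwi Rm); last exact: MR_N.
  by apply: smemD => //; apply: MD_tr.
by apply: smemD => //; apply: MD_tr.
Qed.

Lemma dih_gt_map0 p : srcA0 p -> tgtB0 (dih_gt p).
Proof.
move=> Ap; have [_ [Du Dv]] := dih_gt_maps (srcA0_sle Ap).
move: p Ap Du Dv => [x [y z]] [/= Dx [/= Dy Rz]] Du Dv; split=> //=.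
by rewrite (MRP (MD_R Dx)) (MRP (MD_R Dy)) raddf0 subrr add0r.
Qed.

Lemma dih_f_isogeny : isogeny dih_f srcA (szero _) tgtB (szero _).
Proof.
exact: (quasi_inverse_isogeny fgM3 fgM3 q0 dih_f_maps dih_g_maps dih_gf dih_fg).
Qed.

Lemma dih_ft_isogeny : isogeny dih_ft tgtB (szero _) srcA (szero _).
Proof.
exact: (quasi_inverse_isogeny fgM3 fgM3 q0 dih_ft_maps dih_gt_maps dih_gft dih_ftg).
Qed.

Lemma dih_f_isogeny0 : isogeny dih_f srcA0 (szero _) tgtB0 (szero _).
Proof.
apply: (quasi_inverse_isogeny fgM3 fgM3 q0 dih_f_map0 dih_g_map0) => p.
  by move/srcA0_sle; apply: dih_gf.
by move/tgtB0_sle; apply: dih_fg.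
Qed.

Lemma dih_ft_isogeny0 : isogeny dih_ft tgtB0 (szero _) srcA0 (szero _).
Proof.
apply: (quasi_inverse_isogeny fgM3 fgM3 q0 dih_ft_map0 dih_gt_map0) => p.
  by move/tgtB0_sle; apply: dih_gft.
by move/srcA0_sle; apply: dih_ftg.
Qed.

Lemma proj12_add (p p' : M3) :
  let h (p : M3) := (p.1, p.2.1) : M2 in h (p + p') = h p + h p'.
Proof. by []. Qed.
Definition proj12 := to_additive proj12_add.

(** On [srcA0] the map is (x, y, z) |-> (x + y + z, q x, q y): the identity of M^R on the last
    summand and, modulo it, multiplication by q on (M^D)^2. *)
Lemma herb_dih_f nD (bD : 'I_nD -> M) : tf_basis MD bD ->
  herb l dih_f srcA (szero _) tgtB (szero _) =
    2 * (nD%:Z * (logn l q)%:Z) + herb l gq X1 X0 MT MR.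
Proof.
move=> hD.
have [hi ->] := herb_filtration l srcA0_sle tgtB0_sle dih_f_isogeny dih_f_isogeny0.
congr (_ + _); last first.
  apply: (herb_square hi gq_isogeny (p := proj12) (p' := @fst M M2)).
  - apply: isog_bij => [||[x [y z]] [Sx [Sy _]]|[x [y z]] [Dx [Dy _]]|
      [x [y z]] [_ [_ Rz]] [Dx Dy]|[x y] [Sx Sy]] //.
    + exact: srcA0_sle.
    + exact: X01.
    + by exists (x, (y, 0)); [split=> //; split=> //; apply: smem0|rewrite subrr; apply: smem0].
  - apply: isog_bij => [||[x [y z]]|[x [y z]] []|[x [y z]] [_ [Dy Dz]] Rx|x _] //.
    + exact: tgtB0_sle.
    + by exists (x, (0, 0)); [split=> //; split; apply: smem0|rewrite subrr; apply: smem0].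
  - move=> [x [y z]] [_ [_ Rz]] /=; rewrite opprD addrA subrr add0r.
    exact: smemN.
pose A00 := sprod (szero M) (sprod (szero M) MR).
pose B00 := sprod MR (sprod (szero M) (szero M)).
have AA : sle A00 srcA0.
  by move=> [x [y z]] [/= -> [/= -> Rz]]; split; [|split=> //]; apply: smem0.
have BB : sle B00 tgtB0.
  by move=> [x [y z]] [/= Rx [/= -> ->]]; split=> //; split; apply: smem0.
have [fi0 h0] : isogeny dih_f A00 (szero _) B00 (szero _) /\
    herb l dih_f A00 (szero _) B00 (szero _) = 0.
  apply: isog_bij; try exact: szero_sle; try exact: szero_map.
  - move=> [x [y z]] [/= -> [/= -> Rz]]; rewrite !raddf0 !add0r.
    by split=> //; split.
  - move=> [x [y z]] [/= -> [/= -> Rz]]; rewrite !raddf0 !add0r.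
    by case=> ->.
  - move=> [x [y z]] [/= Rx [/= -> ->]]; exists (0, (0, x)); first by split=> //; split.
    by rewrite /= !raddf0 !add0r subrr; apply: smem0.
have [hi1 ->] := herb_filtration l AA BB dih_f_isogeny0 fi0.
have hDD := tf_basis_prod hD hD.
have [finDD _] := tors_prod (finT MD) (finT MD).
have [qi qh] := herb_scale l fgM2 hDD finDD q0.
rewrite h0 add0r (herb_square hi1 qi (p := proj12) (p' := @snd M M2)).
- by rewrite qh PoszD; ring.
- apply: isog_bij => [||[x [y z]] [Sx [Sy _]]|[x [y z]] [/= -> [/= -> _]]|
      [x [y z]] [_ [_ Rz]] [-> ->]|[x y] [Sx Sy]] //.
  + exact: szero_sle.
  + by exists (x, (y, 0)); [split=> //; split=> //; apply: smem0|rewrite subrr; apply: smem0].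
- apply: isog_bij => [||[x [y z]] [_ []]|[x [y z]] [_ [/= -> ->]]|
      [x [y z]] [Rx _] [/= -> ->]|[x y] [Sx Sy]] //.
  + exact: szero_sle.
  + by exists (0, (x, y)); [split=> //; apply: smem0|rewrite subrr; apply: smem0].
- move=> [x [y z]] [/= /MD_R Dx [/= /MD_R Dy _]].
  by rewrite mulrn_pair (MRN Dx) (MRN Dy) subrr; apply: smem0.
Qed.

(** On [tgtB0] the map is (m, u, v) |-> (m + s m + u, m + s m + v, q m): the identity of (M^D)^2 on
    the last two summands and, modulo them, multiplication by q on M^R. *)
Lemma herb_dih_ft nR (bR : 'I_nR -> M) : tf_basis MR bR ->
  herb l dih_ft tgtB (szero _) srcA (szero _) =
    nR%:Z * (logn l q)%:Z + herb l gqt MT MR X1 X0.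
Proof.
move=> hR.
have [hi ->] := herb_filtration l tgtB0_sle srcA0_sle dih_ft_isogeny dih_ft_isogeny0.
congr (_ + _); last first.
  apply: (herb_square hi gqt_isogeny (p := @fst M M2) (p' := proj12)).
  - apply: isog_bij => [||[x [y z]]|[x [y z]] []|[x [y z]] [_ [Dy Dz]] Rx|x _] //.
    + exact: tgtB0_sle.
    + by exists (x, (0, 0)); [split=> //; split; apply: smem0|rewrite subrr; apply: smem0].
  - apply: isog_bij => [||[x [y z]] [Sx [Sy _]]|[x [y z]] [Dx [Dy _]]|
      [x [y z]] [_ [_ Rz]] [Dx Dy]|[x y] [Sx Sy]] //.
    + exact: srcA0_sle.
    + exact: X01.
    + by exists (x, (y, 0)); [split=> //; split=> //; apply: smem0|rewrite subrr; apply: smem0].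
  - move=> [m [u v]] [_ [/= Du Dv]].
    by split; rewrite /= opprD addrA subrr add0r; apply: smemN.
pose B00 := sprod (szero M) (sprod MD MD).
pose A00 := sprod MD (sprod MD (szero M)).
have AA : sle A00 srcA0.
  by move=> [x [y z]] [/= Dx [/= Dy ->]]; split=> //; split=> //; apply: smem0.
have BB : sle B00 tgtB0.
  by move=> [x [y z]] [/= -> [/= Dy Dz]]; split=> //; apply: smem0.
have [fi0 h0] : isogeny dih_ft B00 (szero _) A00 (szero _) /\
    herb l dih_ft B00 (szero _) A00 (szero _) = 0.
  apply: isog_bij; try exact: szero_sle; try exact: szero_map.
  - move=> [x [y z]] [/= -> [/= Dy Dz]]; rewrite !raddf0 !add0r.
    by split=> //; split.
  - move=> [x [y z]] [/= -> [/= Dy Dz]]; rewrite !raddf0 !add0r.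
    by case=> -> ->.
  - move=> [x [y z]] [/= Dx [/= Dy ->]]; exists (0, (x, y)); first by split=> //; split.
    by rewrite /= !raddf0 !add0r subrr; apply: smem0.
have [hi1 ->] := herb_filtration l BB AA dih_ft_isogeny0 fi0.
have [qi qh] := herb_scale l fgM hR (finT MR) q0.
rewrite h0 add0r (herb_square hi1 qi (p := @fst M M2) (p' := @snd M M \o @snd M M2)).
- by rewrite qh.
- apply: isog_bij => [||[x [y z]] []|[x [y z]] [/= -> _]|
      [x [y z]] [Rx [/= Dy Dz]] /= ->|x Rx] //.
  + exact: szero_sle.
  + by exists (x, (0, 0)); [split=> //; split; apply: smem0|rewrite subrr; apply: smem0].
- apply: isog_bij => [||[x [y z]] [_ []]|[x [y z]] [_ [/= _ ->]]|
      [x [y z]] [Dx [/= Dy Rz]] /= ->|x Rx] //.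
  + exact: szero_sle.
  + by exists (0, (0, x)); [split; [|split=> //]; apply: smem0|rewrite subrr; apply: smem0].
- by move=> [x [y z]] [/= Rx _]; rewrite (MRN Rx) subrr; apply: smem0.
Qed.

Lemma herb_delta :
  isogeny delta MT MR MT MR /\
  herb l delta MT MR MT MR = herb l gq X1 X0 MT MR + herb l gqt MT MR X1 X0.
Proof.
have [si s0] : isogeny swapn X1 X0 X1 X0 /\ herb l swapn X1 X0 X1 X0 = 0.
  apply: isog_bij => [||[x y] [Sx Sy]|[x y] [Dx Dy]|[x y] _ [/= Dy Dx]|[x y] [/= Sx Sy]].
  - exact: X01.
  - exact: X01.
  - by split=> //; apply: smemN.
  - by split=> //; apply: smemN.
  - by split=> //=; rewrite -[x]opprK; apply: smemN.
  - exists (- y, x); first by split=> //; apply: smemN.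
    by rewrite /= opprK subrr; apply: smem0.
have [i1 e1] := herb_comp l gqt_isogeny si.
have [i2 e2] := herb_comp l i1 gq_isogeny.
have [|hi ->] := herb_congr l (g := delta) _ i2.
  by move=> m _; rewrite -gq_swapn_gqt subrr; apply: smem0.
by split=> //; rewrite e2 e1 s0 add0r.
Qed.

(** * The Herbrand quotient of R and the bounds on kernels *)

Program Definition norm_img := @Subgroup M (fun y => exists x, y = N x) _ _.
Next Obligation. by exists 0; rewrite raddf0. Qed.
Next Obligation. by move=> _ _ [x ->] [y ->]; exists (x - y); rewrite raddfB. Qed.

Program Definition norm_ker := @Subgroup M (fun x => N x = 0) _ _.
Next Obligation. exact: raddf0. Qed.
Next Obligation. by move=> x y /= ex ey; rewrite raddfB ex ey subrr. Qed.

Hypothesis augE : forall y, augR r y <-> exists x, y = delta x.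

Program Definition aug := @Subgroup M (augR r) _ _.
Next Obligation. by apply/augE; exists 0; rewrite raddf0. Qed.
Next Obligation.
by move=> _ _ /augE[x ->] /augE[y ->]; apply/augE; exists (x - y); rewrite raddfB.
Qed.

Lemma augP y : aug y <-> exists x, y = delta x.
Proof. exact: augE. Qed.

Lemma N_delta x : N (delta x) = 0.
Proof. by rewrite /= !linE Nw Nwi subrr. Qed.

Lemma muln_split x : x *+ q = N x + delta (- P x).
Proof. by rewrite raddfN deltaE opprB (ops_dP ops) subrKC. Qed.

Lemma delta_eq0 x : delta x = 0 <-> MR x.
Proof.
rewrite deltaE; split=> [/subr0_eq e|Rx]; last by rewrite (MRw Rx) (MRwi Rx) subrr.
by change (r x = x); rewrite -(ops_ww ops) -e wiK.
Qed.

(** Multiplication by q on M^R is the inclusion into M / I_R M followed by the norm. The norm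
    contributes h_R(M). The inclusion contributes as much as [delta] on M / M^R: the cokernels are
    both M / (M^R + I_R M), and [delta] carries its kernel isomorphically onto the intersection of
    M^R and I_R M. *)
Lemma herb_tate nR (bR : 'I_nR -> M) : tf_basis MR bR ->
  [/\ finite_index MR norm_img, finite_index norm_ker aug &
  (vidx l MR norm_img)%:Z - (vidx l norm_ker aug)%:Z + herb l delta MT MR MT MR
    = nR%:Z * (logn l q)%:Z].
Proof.
move=> hR.
have finN : finite_index MR norm_img.
  by apply: (zfg_finite_index fgM q0) => x Rx; exists x; rewrite (MRN Rx).
have finK : finite_index norm_ker aug.
  apply: (zfg_finite_index fgM q0) => x Nx; apply/augP; exists (- P x).
  by rewrite muln_split [N x]Nx add0r.
split=> //.
have [qi qh] := herb_scale l fgM hR (finT MR) q0.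
pose J := sjoin MR aug.
have finJ : finite_index MT J.
  apply: (zfg_finite_index fgM q0) => x _; exists (N x), (delta (- P x)).
  rewrite muln_split; split=> //; first exact: MR_N.
  by apply/augP; exists (- P x).
have finI : finite_index (smeet MR aug) (szero M).
  apply: (zfg_finite_index fgM q0) => x [Rx /augP[y xy]].
  by rewrite -(MRN Rx) xy N_delta; apply: smem0.
have aug_sle : sle aug MT by [].
have idMR x : simg idfun MR x <-> MR x.
  by split=> [[y Ry ->]|Rx] //; exists x.
have idJ x : sjoin (simg idfun MR) aug x <-> J x.
  by split=> -[a [b [/idMR ha hb ->]]]; exists a, b; split=> //; apply/idMR.
have ii : isogeny (@idfun M) MR (szero M) MT aug.
  split=> //; first exact: szero_sle.
  - by move=> x ->; apply: smem0.
  - by apply: finite_index_sub finJ => // x /idJ.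
have N0 x : szero M (N x) <-> norm_ker x by [].
have ni : isogeny N MT aug MR (szero M).
  split=> //; first exact: szero_sle.
  - by move=> x _; apply: MR_N.
  - by move=> x /augP[y ->]; apply: N_delta.
  - by apply: finite_index_sub finN => // _ [x ->]; apply: sjoinl; exists x.
  - by apply: finite_index_sub finK => // x [].
have [ci ch] := herb_comp l ii ni.
have [|_ he] := herb_congr l (g := muln_add M q) _ ci.
  by move=> x Rx; rewrite /= (MRN Rx) subrr.
have hN : herb l N MT aug MR (szero M) = (vidx l MR norm_img)%:Z - (vidx l norm_ker aug)%:Z.
  rewrite /herb /coker_vidx /ker_vidx; congr (_%:Z - _%:Z).
    apply: vidx_eq => //; last by apply: finite_index_sub finN => // _ [x ->]; apply: sjoinl; exists x.
      by move=> _ [_ [b [[x _ ->] -> ->]]]; exists x; rewrite addr0.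
    by move=> _ [x ->]; apply: sjoinl; exists x.
  apply: vidx_eq => //; last by apply: finite_index_sub finK => // x [].
    by move=> x [].
have hI : herb l (@idfun M) MR (szero M) MT aug = herb l delta MT MR MT MR.
  have [[_ _ _ _ dcok dker] _] := herb_delta.
  rewrite /herb /coker_vidx /ker_vidx; congr (_%:Z - _%:Z).
    apply: vidx_eq => //; last by apply: finite_index_sub finJ => // x /idJ.
      move=> _ [a [_ [/idMR Ra /augP[x ->] ->]]]; rewrite addrC.
      by exists (delta x), a; split=> //; exists x.
    move=> _ [_ [b [[x _ ->] Rb ->]]]; rewrite addrC.
    exists b, (delta x); split=> //; first exact/idMR.
    by apply/augP; exists x.
  symmetry; apply: (vidx_iso l (f := delta)) => //.
  - by move=> x [_ Rx]; split=> //; apply/augP; exists x.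
  - by move=> x _; apply: delta_eq0.
  - move=> y [Ry /augP[x yx0]]; have yx : y = delta x := yx0; exists x.
      by split=> //; change (MR (delta x)); rewrite -yx.
    by change (y - delta x = 0); rewrite yx subrr.
by rewrite -hN -hI -ch -he qh.
Qed.

(** An endomorphism of a finite group has kernel and cokernel of equal order; this trades the
    q-torsion, where the kernels embed, for the quotients in the theorem. *)
Lemma tors_quot (A : subgroup M) :
  finite_index (smeet (stors A) (spre (muln_add M q) (szero M))) (szero M) /\
  vidx l (smeet (stors A) (spre (muln_add M q) (szero M))) (szero M) =
  vidx l (stors A) (snmul q (stors A)).
Proof.
have [i h] := herb_finite l (f := muln_add M q) (@szero_sle _ (stors A))
  (@szero_sle _ (stors A)) (fun x => @smemMn _ (stors A) x q)
  (@szero_map _ _ (muln_add M q)) (finT A) (finT A).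
split; first exact: isog_ker i.
have /eqP := h; rewrite subrr subr_eq0 => /eqP[e].
rewrite -/(ker_vidx l (muln_add M q) _ _ _) -e.
apply: vidx_eq => //; last exact: isog_coker i.
  by move=> _ [_ [b [[x Ax ->] -> ->]]]; exists x; rewrite addr0.
by move=> _ [x [Ax ->]]; apply: sjoinl; exists x.
Qed.

Lemma s_delta x : s (delta x) = - delta (s x).
Proof. by rewrite /= !opsE; abel. Qed.

(** The norm kills the image of [delta], while on M^R it is multiplication by q. *)
Lemma MR_delta_tors y : MR (delta y) -> stors MR (delta y) /\ delta y *+ q = 0.
Proof.
move=> Rd; suff e : delta y *+ q = 0 by split=> //; split=> //; exists q.
by rewrite -(MRN Rd) N_delta.
Qed.

(** If x + w y is fixed by R, so is its image x + w^-1 y under s. Applying [delta] to both yields w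
    (delta y) = w^-1 (delta y), so [delta y] is fixed by R. If it is 0, then y, and hence x, lies in
    M^D. *)
Lemma ker_gq_le : (ker_vidx l gq X1 X0 MR <= vidx l (stors MR) (snmul q (stors MR)))%N.
Proof.
have [fin <-] := tors_quot MR.
have xy_fix x y : MS x -> MS y -> MR (x + w y) -> MR (x + wi y).
  by move=> Sx Sy /MR_s; rewrite raddfD sw Sx Sy.
apply: (vidx_inj l (f := delta \o @snd M M) _ _ _ fin).2.
- exact: szero_sle.
- move=> [x y] [[/= Sx Sy] Rm]; have {}Rm : MR (x + w y) := Rm.
  have e1 : delta x + w (delta y) = 0.
    by rewrite -((delta_eq0 _).2 Rm) /= !linE wK wiK; abel.
  have e2 : delta x + wi (delta y) = 0.
    by rewrite -((delta_eq0 _).2 (xy_fix _ _ Sx Sy Rm)) /= !linE wK wiK; abel.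
  apply: MR_delta_tors; apply/delta_eq0; rewrite [LHS]deltaE; apply/eqP.
  by rewrite subr_eq0 -(inj_eq (addrI (delta x))) e1 e2.
- move=> [x y] [[/= Sx Sy] Rm]; have {}Rm : MR (x + w y) := Rm.
  split=> [/delta_eq0 Ry|[_ /= [Ry _]]]; last exact/delta_eq0.
  split=> //; split=> //; change (MR x).
  by rewrite -[x](addrK (w y)); apply: smemB => //; rewrite (MRw Ry).
Qed.

(** Here [delta m] is fixed by R, as a value of [gq] on pairs in M^D, and by s, because s (delta m)
    = - delta (s m) and [delta] kills m + s m. *)
Lemma ker_gqt_le : (ker_vidx l gqt MT MR X0 <= vidx l (stors MD) (snmul q (stors MD)))%N.
Proof.
have [fin <-] := tors_quot MD.
apply: (vidx_inj l (f := delta) _ _ _ fin).2.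
- exact: szero_sle.
- move=> m [_ [/= D1 D2]].
  have Rd : MR (delta m).
    rewrite -gq_swapn_gqt /=; rewrite (MRw (smemN (MD_R D1))).
    by apply: smemD; [apply: MD_R|apply: smemN; apply: MD_R].
  have [[td _] qd] := MR_delta_tors Rd; split=> //; split=> //; split=> //.
  change (s (delta m) = delta m); rewrite s_delta; apply/eqP.
  rewrite eq_sym -addr_eq0 -raddfD; apply/eqP/delta_eq0; exact: (MD_R D1).
- by move=> m _; apply: delta_eq0.
Qed.

Lemma herb_ge_ker (K K' : zmodType) (f : {additive K -> K'}) (A A0' : subgroup K)
    (B B0' : subgroup K') n :
  (ker_vidx l f A A0' B0' <= n)%N -> - herb l f A A0' B B0' <= n%:Z.
Proof. by rewrite /herb; lia. Qed.

(* [vC] is the valuation of the regulator constant, see [regulator_constant] *)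
Lemma dihedral_bounds nD nR (bD : 'I_nD -> M) (bR : 'I_nR -> M) (vC : int) :
    tf_basis MD bD -> tf_basis MR bR ->
    vC = herb l dih_ft tgtB (szero _) srcA (szero _)
         - herb l dih_f srcA (szero _) tgtB (szero _) ->
  let vh := (vidx l MR norm_img)%:Z - (vidx l norm_ker aug)%:Z in
  let bound (A : subgroup M) n :=
    2 * (vidx l (stors A) (snmul q (stors A)))%:Z + 2 * (n%:Z * (logn l q)%:Z) - vh in
  - bound MD nD <= vC <= bound MR nR.
Proof.
move=> hD hR ->; cbv zeta.
rewrite (herb_dih_f hD) (herb_dih_ft hR).
have [_ _ ht] := herb_tate hR; have [_ hd] := herb_delta.
have k1 := herb_ge_ker MT ker_gq_le; have k2 := herb_ge_ker X1 ker_gqt_le.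
move: ht k1 k2; rewrite hd.
(* The upper bound comes out with an extra - 2 rk(M^D) v_l(q), which is dropped. *)
have : 0 <= nD%:Z * (logn l q)%:Z by [].
set a := nD%:Z * _; set b := nR%:Z * _.
move: (herb _ _ _ _ _ _) (herb _ _ _ _ _ _) => h1 h2.
lia.
Qed.

End Dihedral.

(** * The operators of a given dihedral action *)

Section ConcreteOps.
Variables (h : nat) (M : zmodType) (r s : {additive M -> M}).
Let q := h.*2.+1.
Hypothesis rq : forall x, iter q r x = x.
Hypothesis sK : forall x, s (s x) = x.
Hypothesis srs : forall x, s (r (s x)) = iter q.-1 r x.

Lemma iter_raddfD (f : {additive M -> M}) n x y :
  iter n f (x + y) = iter n f x + iter n f y.
Proof. by elim: n => //= n ->; rewrite raddfD. Qed.

Definition iter_add (f : {additive M -> M}) n := to_additive (iter_raddfD f n).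

Lemma iter_addE f n x : iter_add f n x = iter n f x. Proof. by []. Qed.

Lemma normR_add x y : normR q r (x + y) = normR q r x + normR q r y.
Proof. by rewrite /normR -big_split; apply: eq_bigr => i _; rewrite iter_raddfD. Qed.

Definition norm_op := to_additive normR_add.

(** As q = 2h + 1, the square of r^(h + 1) is r and its inverse is r^h. *)
Let w := iter_add r h.+1.
Let wi := iter_add r h.
Let c (i : nat) : int := i%:Z - h%:Z.

Lemma green_add x y :
  let P x := \sum_(i < q) iter i r (w x) *~ c i in P (x + y) = P x + P y.
Proof.
move=> P; rewrite /P -big_split; apply: eq_bigr => i _.
by rewrite (raddfD w) iter_raddfD mulrzDl.
Qed.

(* [h] is subtracted from the coefficients so that [s] anticommutes with it *)
Definition green_op := to_additive green_add.

Let N := norm_op.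
Let P := green_op.

Lemma iterqD n x : iter (n + q) r x = iter n r x.
Proof. by rewrite iterD rq. Qed.

Lemma iter_eqn n m x : n = m -> iter n r x = iter m r x.
Proof. by move=> ->. Qed.

Lemma iterqE n m x : n = (m + q)%N -> iter n r x = iter m r x.
Proof. by move=> ->; apply: iterqD. Qed.

Lemma s_iter n x : (n <= q)%N -> s (iter n r x) = iter (q - n) r (s x).
Proof.
elim: n x => [|n IHn] x nq; first by rewrite subn0 rq.
rewrite /= -{1}[iter n r x]sK srs IHn; last exact: ltnW.
by rewrite -iterD (@iterqE _ (q - n.+1)%N) //; move: nq; rewrite /q; lia.
Qed.

Lemma norm_r x : N (r x) = N x.
Proof.
change (normR q r (r x) = normR q r x); rewrite /normR.
under eq_bigr do rewrite -iterSr.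
by rewrite big_ord_recr [RHS]big_ord_recl /= -[r (iter _ _ _)]/(iter q r x) rq addrC.
Qed.

Lemma r_norm x : r (N x) = N x.
Proof.
rewrite -[RHS]norm_r; change (r (normR q r x) = normR q r (r x)).
by rewrite /normR raddf_sum; apply: eq_bigr => i _; rewrite -iterS iterSr.
Qed.

Lemma norm_iter n x : N (iter n r x) = N x.
Proof. by elim: n => // n <-; apply: norm_r. Qed.

(** The coefficients are odd under i |-> q - 1 - i. Their vanishing sum gives both N P = 0 and P = 0
    on M^R. *)
Lemma sum_c : \sum_(i < q) c i = 0.
Proof.
have h2 : \sum_(i < q) c i + \sum_(i < q) c i = 0.
  rewrite {2}(reindex_inj rev_ord_inj) -big_split big1 // => i _ /=.
  by have := ltn_ord i; rewrite /c /q; lia.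
lia.
Qed.

(** Summation by parts. For n = q and F periodic the boundary terms add up to q F(0), since (q - h)
    + h = q. *)
Lemma sum_telescope (F : nat -> M) n :
  \sum_(i < n) (F i.+1 - F i) *~ c i =
    F n *~ (n%:Z - h%:Z) + F 0%N *~ h%:Z - \sum_(i < n) F i.+1.
Proof.
elim: n => [|n IHn]; first by rewrite !big_ord0 sub0r mulrNz addNr subr0.
rewrite big_ord_recr IHn [in RHS]big_ord_recr /= /c.
set S := \sum_(i < n) F i.+1; set S' := (X in _ = _ - (X + _)); have -> : S' = S by [].
have -> : n.+1%:Z - h%:Z = (n%:Z - h%:Z) + 1 by lia.
by rewrite mulrzBl (mulrzDr _ (n%:Z - h%:Z) 1) mulr1z; abel.
Qed.

Lemma concrete_ops : dihedral_ops q r s w wi N P.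
Proof.
have Nw x : N (w x) = N x by exact: (norm_iter h.+1 x).
have wN x : w (N x) = N x by exact: (iter_fix _ (r_norm x)).
have ww x : w (w x) = r x.
  by rewrite !iter_addE -iterD (@iterqE _ 1%N) //; rewrite /q; lia.
have wfix x : w x = x -> r x = x by move=> e; rewrite -ww !e.
have PE x : P x = \sum_(i < q) iter i r (w x) *~ c i by [].
have NE x : N x = \sum_(i < q) iter i r x by [].
have sN x : s (N x) = N (s x).
  rewrite !NE raddf_sum -[RHS]NE -norm_r NE (reindex_inj rev_ord_inj).
  apply: eq_bigr => i _; rewrite s_iter; last by rewrite ltnW.
  by rewrite -iterSr; apply: iter_eqn; have := ltn_ord i; rewrite /= /q; lia.
split=> //.
- by move=> x; rewrite !iter_addE -iterD (@iterqE _ 0%N) //; rewrite /q; lia.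
- by move=> x; rewrite !iter_addE -iterD (@iterqE _ 0%N) //; rewrite /q; lia.
- by move=> x; apply: iter_fix.
- move=> x; rewrite !iter_addE s_iter; first by apply: iter_eqn; rewrite /q; lia.
  by rewrite /q; lia.
- move=> x /wfix e; rewrite NE; under eq_bigr do rewrite iter_fix //.
  by rewrite sumr_const card_ord.
(* In the group ring s r^i w = r^(q - 1 - i) w s, and the coefficient of index q - 1 - i is the
   opposite one. *)
- move=> x; rewrite !PE raddf_sum -sumrN (reindex_inj rev_ord_inj).
  apply: eq_bigr => i _; rewrite raddfMz -mulrNz.
  have -> : c (rev_ord i) = - c i by have := ltn_ord i; rewrite /c /= /q; lia.
  congr (_ *~ _); rewrite s_iter ?(ltnW (ltn_ord _)) // !iter_addE.
  rewrite s_iter -?iterD; last by rewrite /q; lia.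
  by apply: iter_eqn; have := ltn_ord i; rewrite /= /q; lia.
- move=> x; rewrite !PE raddf_sum; apply: eq_bigr => i _.
  rewrite raddfMz; congr (_ *~ _); rewrite !iter_addE -!iterD.
  by apply: iter_eqn; lia.
- move=> x; rewrite PE raddf_sum.
  under eq_bigr do rewrite raddfMz norm_iter.
  by rewrite -mulrz_sumr sum_c mulr0z.
- move=> x /wfix e; rewrite PE.
  under eq_bigr do rewrite iter_addE !iter_fix //.
  by rewrite -mulrz_sumr sum_c mulr0z.
- move=> x; rewrite PE (raddf_sum w) (raddf_sum wi) -sumrB.
  transitivity (\sum_(i < q) (iter i.+1 r x - iter i r x) *~ c i).
    apply: eq_bigr => i _; rewrite (raddfMz w) (raddfMz wi) -mulrzBl; congr ((_ - _) *~ _).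
      by rewrite !iter_addE -!iterD (@iterqE _ i.+1) //; rewrite /q; lia.
    by rewrite !iter_addE -!iterD (@iterqE _ i) //; rewrite /q; lia.
  rewrite (sum_telescope (fun i => iter i r x)) rq -[iter 0 r x]/x -mulrzDr subrK.
  congr (_ - _); rewrite -[RHS]norm_r NE.
  by apply: eq_bigr => i _; rewrite iterSr.
Qed.

(** R is cyclic, so r^e - 1 = (1 + r + ... + r^(e - 1)) (r - 1), and [delta] is (1 - r) w^-1; the
    factor r^(h + 1) in the witness cancels w^-1. *)
Lemma augR_delta y : augR r y <-> exists x, y = delta w wi x.
Proof.
have deltaE x : delta w wi x = - (r (wi x) - wi x).
  by rewrite opprB.
split.
  move=> [k [e [m ->]]].
  exists (- \sum_(j < k) \sum_(i < e j) iter i r (iter h.+1 r (m j))).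
  rewrite raddfN raddf_sum -sumrN; apply: eq_bigr => j _.
  rewrite raddf_sum -sumrN.
  transitivity (\sum_(i < e j) (iter i.+1 r (m j) - iter i r (m j))).
    by rewrite -(big_mkord xpredT (fun i => iter i.+1 r (m j) - iter i r (m j))) telescope_sumr.
  apply: eq_bigr => i _; rewrite deltaE opprK.
  rewrite !iter_addE -[r (iter h _ _)]iterS -!iterD.
  by congr (_ - _); symmetry; apply: iterqE; rewrite /q; lia.
move=> [x ->]; exists 1%N, (fun=> 1%N), (fun=> - wi x).
by rewrite big_ord1 deltaE /= raddfN opprB opprK addrC.
Qed.

End ConcreteOps.

(** * Valuations *)

Program Definition smult (M : zmodType) (a : M) :=
  @Subgroup M (fun x => exists z : int, x = a *~ z) _ _.
Next Obligation. by exists 0. Qed.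
Next Obligation. by move=> M a _ _ [y ->] [z ->]; exists (y - z); rewrite mulrzBr. Qed.

(** Induction on the index, adjoining to B an element a of A outside it: the order of a modulo B
    divides q, so it is prime to l. *)
Lemma finite_index_coprime (l q : nat) (M : zmodType) (A B : subgroup M) n :
    prime l -> ~~ (l %| q)%N -> sle B A -> (forall x, A x -> B (x *+ q)) ->
  has_qcard A B n -> logn l n = 0%N.
Proof.
move=> pl lq; have q0 : (0 < q)%N by case: q lq; rewrite ?dvdn0.
elim/ltn_ind: n B => n IHn B BA qA hn.
have [[a Aa nBa]|no] := excluded_middle_informative (exists2 a, A a & ~ B a); last first.
  have AB : sle A B.
    move=> a Aa; have [//|nBa] := excluded_middle_informative (B a).
    by case: no; exists a.
  have [f [fA fcov finj]] := hn.
  have : (n <= 1)%N.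
    rewrite leqNgt; apply/negP => n1.
    have e := finj (Ordinal (ltnW n1)) (Ordinal n1) (smemB (AB _ (fA _)) (AB _ (fA _))).
    by have := congr1 val e.
  by case: n {IHn hn f fA fcov finj} => [|[|]] //; rewrite ?logn0 ?logn1.
have [o [o0 Bo omin]] : exists o, [/\ (0 < o)%N, B (a *+ o) &
    forall o', (0 < o')%N -> B (a *+ o') -> (o <= o')%N].
  move: (q) q0 (qA a Aa); elim/ltn_ind => m IHm m0 Bm.
  have [[p [pm p0 Bp]]|no] := excluded_middle_informative
      (exists p, [/\ (p < m)%N, (0 < p)%N & B (a *+ p)]); first exact: IHm Bp.
  exists m; split=> // p p0 Bp; rewrite leqNgt; apply/negP => pm.
  by apply: no; exists p.
have modB k : B (a *+ k) -> (k %% o)%N = 0%N.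
  move=> Bk; apply/eqP/negPn/negP; rewrite -lt0n => k0.
  have : (o <= k %% o)%N.
    apply: omin => //.
    have -> : a *+ (k %% o) = a *+ k - a *+ o *+ (k %/ o).
      by rewrite {2}(divn_eq k o) mulnC mulrnDr mulrnA addrC addKr.
    by apply: smemB => //; apply: smemMn.
  by rewrite leqNgt ltn_mod o0.
pose B' := sjoin B (smult a).
have hB' : has_qcard B' B o.
  exists (fun i : 'I_o => a *+ i); split=> [i|_ [b [_ [Bb [z ->] ->]]]|i j].
  - by apply: sjoinr; exists i.
  - have o_neq0 : o%:Z != 0 by rewrite eqz_nat -lt0n.
    have := modz_ge0 z o_neq0; have := ltz_mod z o_neq0; rewrite ger0_norm //.
    case er : (z %% o)%Z => [t|t] // lt _; have {}lt : (t < o)%N by [].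
    exists (Ordinal lt); change (B (b + a *~ z - a *~ t)).
    have -> : b + a *~ z - a *~ t = b + a *+ o *~ (z %/ o)%Z.
      rewrite {1}(divz_eq z o) er mulrzDr mulrC mulrzA -pmulrn addrA addrK.
      by [].
    by apply: smemD => //; apply: smemMz.
  - wlog ij : i j / (i <= j)%N => [hw Bij|Bij].
      have [/hw|/ltnW ji] := leqP i j; first exact.
      by symmetry; apply: hw => //; rewrite -opprB; apply: smemN.
    have : ((j - i) %% o)%N = 0%N.
      by apply: modB; rewrite mulrnBr // -opprB; apply: smemN.
    have jo : (j - i < o)%N by apply: leq_ltn_trans (ltn_ord j); apply: leq_subr.
    by rewrite modn_small // => ji; apply/val_inj; move: ij ji => /=; lia.
have BB' : sle B B' by move=> x; apply: sjoinl.
have B'A : sle B' A.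
  by apply: sjoin_sub => // _ [z ->]; apply: smemMz.
have [m hm] : finite_index A B' by apply: (@finite_index_sub _ A A B B') => //; exists n.
have nm := has_qcard_uniq hn (has_qcard_tower B'A BB' hm hB').
have o1 : (1 < o)%N.
  rewrite ltn_neqAle o0 andbT; apply: contra_not_neq nBa => o1.
  by rewrite -[a]mulr1n o1.
have m0 := has_qcard_gt0 hm.
rewrite nm lognM // (IHn m _ B' B'A _ hm) ?nm; first last.
- by move=> x Ax; apply/BB'/qA.
- by rewrite ltn_Pmulr.
rewrite add0n lognE pl o0 /=; case: ifP => // lo; case/negP: lq.
by apply: dvdn_trans lo _; apply/eqP/modB/qA.
Qed.

Lemma vidx_coprime (l q : nat) (M : zmodType) (A B : subgroup M) :
    zfg M -> prime l -> ~~ (l %| q)%N -> sle B A -> (forall x, A x -> B (x *+ q)) ->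
  vidx l A B = 0%N.
Proof.
move=> fgM pl lq BA qA; have q0 : (0 < q)%N by case: q lq {qA}; rewrite ?dvdn0.
have [n hn] := zfg_finite_index fgM q0 qA.
by rewrite (vidxE l hn); apply: finite_index_coprime pl lq BA qA hn.
Qed.

Lemma ratio_cross (x y : int) : y != 0 ->
  numq (x%:~R / y%:~R) * y = x * denq (x%:~R / y%:~R).
Proof.
move=> y0; apply: (@intr_inj rat); rewrite !intrM.
have yq : y%:~R != 0 :> rat by rewrite intr_eq0.
have dq : (denq (x%:~R / y%:~R))%:~R != 0 :> rat by rewrite intr_eq0 denq_neq0.
apply: (mulIf (invr_neq0 dq)); rewrite mulfK //.
by rewrite mulrAC divq_num_den divfK.
Qed.

(** The fraction need not be reduced: cross-multiplication with numerator and denominator gives the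
    same difference. *)
Lemma vrat_ratio (l : nat) (x y : int) : x != 0 -> y != 0 ->
  vrat l (x%:~R / y%:~R) = (logn l `|x|)%:Z - (logn l `|y|)%:Z.
Proof.
move=> x0 y0; rewrite /vrat; have e := ratio_cross x y0.
set c : rat := x%:~R / y%:~R in e *.
have c0 : numq c != 0 by rewrite numq_eq0 mulf_neq0 ?invr_eq0 ?intr_eq0.
have := congr1 (logn l \o absz) e; rewrite /= !abszM !lognM ?absz_gt0 ?denq_neq0 //.
lia.
Qed.

Lemma intr_neq0_char0 (L : fieldType) (z : int) : [pchar L] =i pred0 ->
  z != 0 -> z%:~R != 0 :> L.
Proof.
move=> L0 z0; have nz n : n != 0%N -> n%:R != 0 :> L by rewrite (pcharf0P L).1.
case: z z0 => n n0; first exact: nz.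
by rewrite NegzE mulrNz oppr_eq0; apply: nz.
Qed.

Lemma ratr_ratio (L : fieldType) (x y : int) : [pchar L] =i pred0 -> y != 0 ->
  ratr (x%:~R / y%:~R) = x%:~R / y%:~R :> L.
Proof.
move=> L0 y0; have yL := intr_neq0_char0 L0 y0.
have dL := intr_neq0_char0 L0 (denq_neq0 (x%:~R / y%:~R)).
apply/eqP; rewrite /ratr eqr_div //; apply/eqP.
by rewrite -!intrM ratio_cross.
Qed.

(** * Pairings on products *)

Definition prodpr (M N : zmodType) (L : fieldType) (p1 : M -> M -> L)
  (p2 : N -> N -> L) (x y : M * N) : L := p1 x.1 y.1 + p2 x.2 y.2.

Definition scalepr (M : zmodType) (L : fieldType) (c : L) (p : M -> M -> L) x y : L :=
  c * p x y.

Definition biadditive (M : zmodType) (L : fieldType) (p : M -> M -> L) :=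
  (forall x y z, p (x + y) z = p x z + p y z) /\
  (forall x y z, p x (y + z) = p x y + p x z).

Lemma biadditive_scale (M : zmodType) (L : fieldType) (c : L) (p : M -> M -> L) :
  biadditive p -> biadditive (scalepr c p).
Proof. by move=> [pl pr]; split=> x y z; rewrite /scalepr ?pl ?pr mulrDr. Qed.

Lemma biadditive_prod (M N : zmodType) (L : fieldType) (p1 : M -> M -> L)
  (p2 : N -> N -> L) : biadditive p1 -> biadditive p2 -> biadditive (prodpr p1 p2).
Proof.
by move=> [l1 r1] [l2 r2]; split=> x y z; rewrite /prodpr /= ?l1 ?l2 ?r1 ?r2 addrACA.
Qed.

Lemma gram_scale (M : zmodType) (L : fieldType) (c : L) (p : M -> M -> L) n
    (b : 'I_n -> M) : gram (scalepr c p) b = c *: gram p b.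
Proof. by apply/matrixP => i j; rewrite !mxE. Qed.

Lemma det_gram_prod (M N : zmodType) (L : fieldType) (p1 : M -> M -> L)
    (p2 : N -> N -> L) n m (a : 'I_n -> M) (b : 'I_m -> N) :
    biadditive p1 -> biadditive p2 ->
  \det (gram (prodpr p1 p2) (basis_prod a b)) = \det (gram p1 a) * \det (gram p2 b).
Proof.
move=> [l1 r1] [l2 r2].
have p0l (K : zmodType) (p : K -> K -> L) : (forall x y z, p (x + y) z = p x z + p y z) ->
    forall y, p 0 y = 0.
  by move=> pD y; apply: (addrI (p 0 y)); rewrite -pD !addr0.
have p0r (K : zmodType) (p : K -> K -> L) : (forall x y z, p x (y + z) = p x y + p x z) ->
    forall x, p x 0 = 0.
  by move=> pD x; apply: (addrI (p x 0)); rewrite -pD !addr0.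
have -> : gram (prodpr p1 p2) (basis_prod a b) = block_mx (gram p1 a) 0 0 (gram p2 b).
  apply/matrixP => i j; rewrite mxE.
  case: (split_ordP i) => i' ->; case: (split_ordP j) => j' ->;
    rewrite ?basis_prodl ?basis_prodr /prodpr /= ?(p0l _ _ l1) ?(p0l _ _ l2)
      ?(p0r _ _ r1) ?(p0r _ _ r2) ?addr0 ?add0r
      ?block_mxEul ?block_mxEur ?block_mxEdl ?block_mxEdr ?mxE //.
exact: det_ublock.
Qed.

(** * The regulator constant *)

Section Regulator.
Variables (l q : nat) (M : zmodType) (r s w wi N P : {additive M -> M}).
Hypothesis ops : dihedral_ops q r s w wi N P.
Hypothesis q0 : (0 < q)%N.
Hypothesis fgM : zfg M.
Variables (L : fieldType) (pr : M -> M -> L).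
Hypothesis L_char0 : [pchar L] =i pred0.
Hypothesis pr_bi : biadditive pr.
Hypothesis prw : forall x y, pr (w x) y = pr x (wi y).
Hypothesis prs : forall x y, pr (s x) y = pr x (s y).
Hypothesis prNl : forall x y, sinvR r y -> pr (N x) y = q%:R * pr x y.
Hypothesis prNr : forall x y, sinvR r x -> pr x (N y) = q%:R * pr x y.
Variables (n1 nD nR nS : nat) (b1 : 'I_n1 -> M) (bD : 'I_nD -> M)
  (bR : 'I_nR -> M) (bS : 'I_nS -> M).
Hypotheses (hb1 : tf_basis (sfull M) b1) (hbD : tf_basis (sinvD r s) bD).
Hypotheses (hbR : tf_basis (sinvR r) bR) (hbS : tf_basis (sinvS s) bS).
Hypothesis G1 : \det (gram pr b1) != 0.

Let finT := tors_finite fgM hb1.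

Let nzL n : (0 < n)%N -> n%:R != 0 :> L.
Proof. by rewrite (pcharf0P L).1 // -lt0n. Qed.

Let prl := pr_bi.1.
Let prr := pr_bi.2.

Lemma sym_add (x y : M) : (x + y) + s (x + y) = (x + s x) + (y + s y).
Proof. by rewrite raddfD; abel. Qed.

Let sym := to_additive sym_add.

Lemma gram_fixed_neq0 :
  [/\ \det (gram pr bR) != 0, \det (gram pr bS) != 0 & \det (gram pr bD) != 0].
Proof.
split.
- apply: (gram_neq0 (p := N) (k := q) L_char0 prl prr G1 hb1 hbR q0).
  + by move=> x; apply: (MR_N ops).
  + by move=> x; apply: (MRN ops).
  + by move=> x y Rx; rewrite prNr // mulr_natl.
- apply: (gram_neq0 (p := sym) (k := 2) L_char0 prl prr G1 hb1 hbS) => //.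
  + by move=> x; apply: (MS_tr ops).
  + by move=> x Sx; rewrite /= (MSx Sx) mulr2n.
  + by move=> x y Sx; rewrite /= prr -prs (MSx Sx) mulr2n.
- apply: (gram_neq0 (p := N \o sym) (k := (2 * q)%N) L_char0 prl prr G1 hb1 hbD).
  + by rewrite muln_gt0.
  + by move=> x; apply/(MD_N ops)/(MS_tr ops).
  + move=> x [Rx Sx] /=; rewrite Sx (MRN ops); last exact: smemD.
    by rewrite -mulr2n mulrnA.
  + move=> x y [Rx Sx]; rewrite [LHS]mulrnA /= prNr // prr -prs Sx.
    by rewrite mulr_natl -mulr2n.
Qed.

(** The pairings weighted by 1/|H|: the negative terms 2 Sigma + R of Theta in [prA], the positive
    terms 1 + 2 D in [prB]. *)
Let prA := prodpr (scalepr 2%:R^-1 pr) (prodpr (scalepr 2%:R^-1 pr) (scalepr q%:R^-1 pr)).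
Let prB := prodpr (scalepr 1%:R^-1 pr)
  (prodpr (scalepr (2 * q)%:R^-1 pr) (scalepr (2 * q)%:R^-1 pr)).

(** With these weights inclusions of fixed points are adjoint to norms: <x, m> = 1/2 <x, m + s m>
    for x in M^S, and <z, m> = 1/q <z, N m> for z in M^R. *)
Lemma dih_adjoint x y : srcA r s x -> tgtB r s y ->
  prB (dih_f w N x) y = prA x (dih_ft s wi N y).
Proof.
move: x y => [x [y z]] [m [u v]] [/= Sx [/= Sy Rz]] [_ [/= [Ru _] [Rv _]]].
rewrite /prB /prA /prodpr /scalepr /= !prl !prr !prNl ?prNr //.
rewrite -!prs (MSx Sx) (MSx Sy) prw natrM.
have q1 := nzL q0; have two := @nzL 2 isT.
by field; rewrite q1 two oner_neq0.
Qed.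

(** The torsion orders enter the valuations of h(f) and h(f') once each, with opposite signs, so the
    difference contains them twice: these are the factors |M_tors^H|^-2. *)
Lemma regulator_constant :
  exists c : rat,
    [/\ c != 0,
        regC_Theta q r s pr b1 bD bR bS = ratr c &
        vrat l c =
          herb l (dih_ft s wi N) (tgtB r s) (szero _) (srcA r s) (szero _)
          - herb l (dih_f w N) (srcA r s) (szero _) (tgtB r s) (szero _)].
Proof.
have fgM2 := zfg_prod fgM fgM; have fgM3 := zfg_prod fgM fgM2.
have biS c : biadditive (scalepr c pr) by apply: biadditive_scale.
have bA : biadditive prA by do 2!apply: biadditive_prod => //.
have bB : biadditive prB by do 2!apply: biadditive_prod => //.
have hA := tf_basis_prod hbS (tf_basis_prod hbS hbR).
have hB := tf_basis_prod hb1 (tf_basis_prod hbD hbD).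
have [finSR tSR] := tors_prod (finT (sinvS s)) (finT (sinvR r)).
have [finA tA] := tors_prod (finT (sinvS s)) finSR.
have [finDD tDD] := tors_prod (finT (sinvD r s)) (finT (sinvD r s)).
have [finB tB] := tors_prod (finT (sfull M)) finDD.
have [u [v [u0 v0 rel hf hft]]] := adjoint_gram l L_char0 bA.2 bB.1 fgM3 fgM3 hA hB
  finA finB q0 (dih_f_maps ops) (dih_g_maps ops) (dih_gt_maps ops) (dih_ft_maps ops)
  (dih_gf ops) (dih_fg ops) (dih_ftg ops) (dih_gft ops) dih_adjoint.
have det3 (c1 c2 c3 : L) k1 k2 k3 (e1 : 'I_k1 -> M) (e2 : 'I_k2 -> M) (e3 : 'I_k3 -> M) :
    \det (gram (prodpr (scalepr c1 pr) (prodpr (scalepr c2 pr) (scalepr c3 pr)))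
      (basis_prod e1 (basis_prod e2 e3))) =
    \det (c1 *: gram pr e1) * (\det (c2 *: gram pr e2) * \det (c3 *: gram pr e3)).
  by rewrite !det_gram_prod ?gram_scale //; apply: biadditive_prod.
rewrite !det3 in rel.
pose T1 := scard (tors_in (sfull M)); pose TD := scard (tors_in (sinvD r s)).
pose TR := scard (tors_in (sinvR r)); pose TS := scard (tors_in (sinvS s)).
have Tpos (A : subgroup M) : (0 < scard (tors_in A))%N.
  exact: (has_qcard_gt0 (qcardP (finT A))).
have [[[T1p TDp] TRp] TSp] := (Tpos (sfull M), Tpos (sinvD r s), Tpos (sinvR r), Tpos (sinvS s)).
(* The ratio v / u comes from the Gram determinants, the squares from the torsion factors with the
   signs and multiplicities of Theta. *)
pose x : int := v * ((TR * TS ^ 2) ^ 2)%N%:Z.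
pose y : int := u * ((T1 * TD ^ 2) ^ 2)%N%:Z.
have x0 : x != 0.
  by rewrite mulf_neq0 // eqz_nat -lt0n !(expn_gt0, muln_gt0) TRp TSp.
have y0 : y != 0.
  by rewrite mulf_neq0 // eqz_nat -lt0n !(expn_gt0, muln_gt0) T1p TDp.
exists (x%:~R / y%:~R); split.
- by rewrite mulf_neq0 ?invr_eq0 ?intr_eq0.
- rewrite ratr_ratio // /regC_Theta /reg_factor.
  rewrite -[scard (tors_in (fun=> True))]/T1 -[scard (tors_in (invD r s))]/TD.
  rewrite -[scard (tors_in (invR r))]/TR -[scard (tors_in (invS s))]/TS.
  have ex : x%:~R = v%:~R * (TR%:R * TS%:R ^+ 2) ^+ 2 :> L.
    by rewrite /x intrM -!natrX -natrM -natrX.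
  have ey : y%:~R = u%:~R * (T1%:R * TD%:R ^+ 2) ^+ 2 :> L.
    by rewrite /y intrM -!natrX -natrM -natrX.
  rewrite ex ey.
  have [GR GS GD] := gram_fixed_neq0.
  have uL := intr_neq0_char0 L_char0 u0.
  move: (nzL T1p) (nzL TDp) (nzL TRp) (nzL TSp).
  have dR : \det (q%:R^-1 *: gram pr bR) != 0.
    by rewrite detZ mulf_neq0 // expf_neq0 // invr_neq0 // nzL.
  have dS : \det (2%:R^-1 *: gram pr bS) != 0.
    by rewrite detZ mulf_neq0 // expf_neq0 // invr_neq0 // nzL.
  move: rel dR dS.
  set d1 := \det _; set dD := \det _; set dS := \det _; set dR := \det _.
  rewrite -/T1 -/TD -/TR -/TS.
  move: (T1%:R : L) (TD%:R : L) (TR%:R : L) (TS%:R : L) => t1 tD tR tS.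
  move=> rel dR0 dS0 t1n tDn tRn tSn.
  have e1 : d1 * dD ^+ 2 = v%:~R / u%:~R * (dS ^+ 2 * dR).
    apply: (mulfI uL); rewrite [RHS]mulrA [u%:~R * (_ / _)]mulrC divfK //.
    by rewrite !expr2 -!mulrA in rel *.
  transitivity (d1 * dD ^+ 2 * (tR * tS ^+ 2) ^+ 2 / ((t1 * tD ^+ 2) ^+ 2 * (dS ^+ 2 * dR))).
    by field; rewrite ?t1n ?tDn ?tRn ?tSn ?dR0 ?dS0.
  by rewrite e1; field; rewrite ?t1n ?tDn ?tRn ?tSn ?dR0 ?dS0 ?uL.
- rewrite vrat_ratio // /x /y !abszM !absz_nat.
  have logT (a b : nat) : (0 < a)%N -> (0 < b)%N ->
      logn l ((a * b ^ 2) ^ 2) = (2 * (logn l a + 2 * logn l b))%N.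
    by move=> a0 b0; rewrite lognX lognM ?expn_gt0 ?b0 // lognX.
  have sq0 (a b : nat) : (0 < a)%N -> (0 < b)%N -> (0 < (a * b ^ 2) ^ 2)%N.
    by move=> a0 b0; rewrite expn_gt0 muln_gt0 a0 expn_gt0 b0.
  move: (logT _ _ TRp TSp) (sq0 _ _ TRp TSp) (logT _ _ T1p TDp) (sq0 _ _ T1p TDp).
  move: ((TR * TS ^ 2) ^ 2)%N ((T1 * TD ^ 2) ^ 2)%N => X Y hX X0 hY Y0.
  rewrite !lognM ?absz_gt0 // hX hY.
  rewrite hf hft tA tSR tB tDD -[logn l T1]/(vidx l (stors (sfull M)) (szero M)).
  rewrite -[logn l TD]/(vidx l (stors (sinvD r s)) (szero M)).
  rewrite -[logn l TR]/(vidx l (stors (sinvR r)) (szero M)).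
  rewrite -[logn l TS]/(vidx l (stors (sinvS s)) (szero M)).
  lia.
Qed.

End Regulator.

(** * The theorem for a given action and pairing *)

Lemma dih_fingen_zfg q (M : zmodType) (r s : M -> M) : dih_fingen q r s -> zfg M.
Proof.
move=> [gs hgs].
pose I := ('I_(size gs) * ('I_q * 'I_2))%type.
pose g (p : I) := dact r s p.2.1 p.2.2 (gs`_p.1).
exists #|{: I}|, (g \o enum_val) => m; have [c ->] := hgs m.
pose c' (p : I) := c p.1 p.2.1 p.2.2.
exists (c' \o enum_val).
rewrite -(reindex (op := +%R) enum_val (P := xpredT) (F := fun p : I => g p *~ c' p)) /=; last first.
  exact: onW_bij (enum_val_bij _).
under eq_bigr do rewrite pair_bigA.
by rewrite pair_bigA.
Qed.

Theorem mainTheorem10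
  (q : nat) (q_gt1 : (1 < q)%N) (q_odd : odd q)
  (M : zmodType) (r s : M -> M)
  (hact : dihedral_action q r s) (hfg : dih_fingen q r s)
  (l : nat) (l_prime : prime l)
  (L : fieldType) (L_char0 : [pchar L] =i pred0)
  (pr : M -> M -> L) (hpr : good_pairing r s pr)
  (n1 nD nR nS : nat)
  (b1 : 'I_n1 -> M) (bD : 'I_nD -> M) (bR : 'I_nR -> M) (bS : 'I_nS -> M)
  (hb1 : tf_basis (fun _ => True) b1) (hbD : tf_basis (invD r s) bD)
  (hbR : tf_basis (invR r) bR) (hbS : tf_basis (invS s) bS) :
  let vhR : int := vnat l (hhat0R q r) - vnat l (hhatm1R q r) in
  let Lb : int :=
    if (l %| q)%N then
      2 * vnat l (qcard (tors_in (invD r s)) (nmul_set q (tors_in (invD r s))))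
      + 2 * (nD%:Z * vnat l q) - vhR
    else 0 in
  let Ub : int :=
    if (l %| q)%N then
      2 * vnat l (qcard (tors_in (invR r)) (nmul_set q (tors_in (invR r))))
      + 2 * (nR%:Z * vnat l q) - vhR
    else 0 in
  exists c : rat,
    [/\ c != 0,
        regC_Theta q r s pr b1 bD bR bS = ratr c &
        - Lb <= vrat l c <= Ub].
Proof.
move=> vhR Lb Ub.
have [h qh] : exists h, q = h.*2.+1 by exists q./2; rewrite -{1}(odd_double_half q) q_odd.
subst q; set q := h.*2.+1 in hact hfg vhR Lb Ub *.
have q0 : (0 < q)%N by [].
have [rD sD rq sK srs] := hact.
pose ra : {additive M -> M} := to_additive rD.
pose sa : {additive M -> M} := to_additive sD.
have ops := concrete_ops (r := ra) (s := sa) rq sK srs.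
have augE := augR_delta (r := ra) rq.
have fgM := dih_fingen_zfg hfg.
have [prl prr prr_inv prs_inv nondeg] := hpr.
have prw_inv n x y : pr (iter n r x) (iter n r y) = pr x y.
  by elim: n => //= n IHn; rewrite prr_inv.
have G1 := nondeg _ _ hb1.
have finT := tors_finite fgM hb1.
have prw x y : pr (iter_add ra h.+1 x) y = pr x (iter_add ra h y).
  by rewrite -{1}(ops_wiK ops y); apply: (prw_inv h.+1).
have prs x y : pr (sa x) y = pr x (sa y).
  by rewrite -{1}(ops_sK ops y); apply: prs_inv.
have prNl x y : sinvR ra y -> pr (norm_op h ra x) y = q%:R * pr x y.
  move=> Ry; change (pr (\sum_(i < q) iter i r x) y = q%:R * pr x y).
  pose p := to_additive (fun x x' => prl x x' y).
  change (p (\sum_(i < q) iter i r x) = q%:R * pr x y); rewrite raddf_sum.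
  under eq_bigr => i _.
    have -> : p (iter i r x) = pr x y.
      by rewrite -[RHS](prw_inv i) (iter_fix _ Ry).
    over.
  by rewrite sumr_const card_ord mulr_natl.
have prNr x y : sinvR ra x -> pr x (norm_op h ra y) = q%:R * pr x y.
  move=> Rx; change (pr x (\sum_(i < q) iter i r y) = q%:R * pr x y).
  pose p := to_additive (prr x).
  change (p (\sum_(i < q) iter i r y) = q%:R * pr x y); rewrite raddf_sum.
  under eq_bigr => i _.
    have -> : p (iter i r y) = pr x y.
      by rewrite -[RHS](prw_inv i) (iter_fix _ Rx).
    over.
  by rewrite sumr_const card_ord mulr_natl.
have [c [c0 hc vc]] := regulator_constant l ops q0 fgM L_char0 (conj prl prr) prw prs
  prNl prNr hb1 (hbD : tf_basis (sinvD ra sa) bD) (hbR : tf_basis (sinvR ra) bR)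
  (hbS : tf_basis (sinvS sa) bS) G1.
exists c; split=> //.
have := dihedral_bounds ops q0 fgM finT augE hbD hbR vc; cbv zeta.
have -> : (vidx l (sinvR ra) (norm_img (norm_op h ra)))%:Z -
    (vidx l (norm_ker (norm_op h ra)) (aug augE))%:Z = vhR by [].
(* For l prime to q the general bounds are themselves 0: the torsion quotients and the Tate groups
   are killed by q, so their orders are prime to l. *)
rewrite /Lb /Ub; case: ifP => [//|/negbT lq].
have [finN finK _] := herb_tate l ops q0 fgM finT augE hbR.
have tors0 (A : subgroup M) : vidx l (stors A) (snmul q (stors A)) = 0%N.
  apply: (vidx_coprime fgM l_prime lq) => [_ [x [Ax ->]]|x Ax]; first exact: smemMn.
  by exists x.
have lq0 : logn l q = 0%N by rewrite lognE (negPf lq) !andbF.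
have vh0 : vhR = 0.
  rewrite /vhR -[vnat l _]/((vidx l (sinvR ra) (norm_img (norm_op h ra)))%:Z).
  rewrite -[vnat l (hhatm1R _ _)]/((vidx l (norm_ker (norm_op h ra)) (aug augE))%:Z).
  rewrite (vidx_coprime fgM l_prime lq) => [|_ [x ->]|x Rx].
  - rewrite (vidx_coprime fgM l_prime lq) // => [_ /(augP augE)[x ->]|x Nx].
      exact: (N_delta ops).
    apply/(augP augE); exists (- green_op h ra x).
    by rewrite (muln_split ops) [norm_op h ra x]Nx add0r.
  - exact: (MR_N ops).
  - by exists x; rewrite (MRN ops Rx).
by rewrite vh0 !tors0 lq0 !mulr0.
Qed.
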